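(* Let $G\subset\mathbb{C}$ be an open set, let $f$ be a function meromorphic on an open set $G'\supset \mathrm{cl}(G)$, let $\epsilon\in(0,\infty)$, and let $\Lambda$ be a bounded connected component of the level set $E_{f,\epsilon}=\{z\in G' : |f(z)|=\epsilon\}$ with $\Lambda\subset G$. Then the critical points of $f$ contained in $\Lambda$ are the vertices of the planar graph $\Lambda$. If $\Lambda$ does not contain any critical point of $f$, then $\Lambda$ is a simple closed path.
   Context: A critical point of $f$ is a zero of $f'$. A planar graph means a finite graph embedded in a plane or sphere whose edges do not cross (loops and multiple edges are allowed); a simple closed path (with no vertices) is also counted as a planar graph. That the critical points of $f$ in $\Lambda$ are the vertices of $\Lambda$ means that $\Lambda$ carries a planar graph structure whose vertex set is exactly the set of critical points of $f$ in $\Lambda$, the edges being paths in $\Lambda$ with endpoints at critical points of $f$ (the two endpoints of an edge may coincide) and with no critical points in their interiors. *)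

(* Defs.v *)
From HB Require Import structures.
From mathcomp Require Import all_boot all_order all_algebra.
From mathcomp Require Import all_classical all_reals all_analysis.
From mathcomp Require Import complex.

Set Implicit Arguments.
Unset Strict Implicit.
Unset Printing Implicit Defensive.

Import Order.TTheory GRing.Theory Num.Theory numFieldNormedType.Exports.

Local Open Scope classical_set_scope.
Local Open Scope ring_scope.
Local Open Scope complex_scope.

(* Typing R[i] as a numFieldType gives it the norm, the topology and the
   normed module structure (over itself) of a numeric field, so that
   [derivable f z 1] below is complex differentiability of f at z. *)
Definition Cplx (R : realType) : numFieldType := R[i].

Definition is_pole (R : realType) (f : Cplx R -> Cplx R) (z : Cplx R) : Prop :=
  `|f w| @[w --> z^'] --> +oo.

(* A meromorphic function is represented by a total function whose values at
   its poles and outside of U are irrelevant. The first clause makes the poles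
   isolated. *)
Definition meromorphic (R : realType) (U : set (Cplx R))
    (f : Cplx R -> Cplx R) : Prop :=
  forall z, U z ->
    (\forall w \near z^', derivable f w 1) /\ (derivable f z 1 \/ is_pole f z).

Definition critical_point (R : realType) (f : Cplx R -> Cplx R) (z : Cplx R) :
    Prop :=
  derivable f z 1 /\ derive1 f z = 0.

(* Poles are excluded explicitly since the value f z is junk there. *)
Definition level_set (R : realType) (U : set (Cplx R)) (f : Cplx R -> Cplx R)
    (eps : R) : set (Cplx R) :=
  [set z | [/\ U z, ~ is_pole f z & `|f z| = eps%:C]].

Definition is_connected_component (T : topologicalType) (E L : set T) : Prop :=
  exists2 x, E x & L = connected_component E x.

Definition simple_closed_path (R : realType) (L : set (Cplx R)) : Prop :=
  exists g : R -> Cplx R,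
    [/\ {within `[0, 1], continuous g},
        g 0 = g 1,
        {in `[0, 1[ &, injective g} &
        L = g @` `[0, 1]].

(* The path g need not have distinct endpoints (loops are allowed). *)
Definition is_edge (R : realType) (V : set (Cplx R)) (g : R -> Cplx R) : Prop :=
  [/\ {within `[0, 1], continuous g},
      V (g 0) /\ V (g 1),
      {in `]0, 1[ &, injective g} &
      forall t, t \in `]0, 1[ -> ~ V (g t)].

(* L, with vertex set V, is a finite graph embedded in the plane; edges are
   indexed, which allows multiple edges, and meet only at vertices. *)
Definition embedded_graph (R : realType) (L V : set (Cplx R)) : Prop :=
  finite_set V /\
  exists (n : nat) (e : 'I_n -> R -> Cplx R),
    [/\ forall i, is_edge V (e i),
        forall i j s t, s \in `]0, 1[ -> t \in `]0, 1[ -> i != j ->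
          e i s <> e j t &
        L = V `|` \bigcup_(i in [set: 'I_n]) (e i @` `[0, 1])].

Definition planar_graph (R : realType) (L V : set (Cplx R)) : Prop :=
  embedded_graph L V \/ (V = set0 /\ simple_closed_path L).

(* Main.v *)
Require Import Defs.
From HB Require Import structures.
From mathcomp Require Import all_boot all_order all_algebra.
From mathcomp Require Import all_classical all_reals all_analysis.
From mathcomp Require Import finmap complex ring lra.

Set Implicit Arguments.
Unset Strict Implicit.
Unset Printing Implicit Defensive.

Import Order.TTheory GRing.Theory Num.Theory numFieldNormedType.Exports.

Local Open Scope classical_set_scope.
Local Open Scope ring_scope.

(* Near a point of [L] the function is holomorphic, and Goursat's theorem and the
   resulting Cauchy formula on a square give [f (z0 + w) = f z0 + w ^ (m + 1) G w]
   with [G] Lipschitz and [G 0 <> 0], unless [f] is constant near [z0]. The latter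
   would make [L] both compact and open. Hence the fibers of [f] on [L] and the
   critical points on [L] are finite in number, and near a noncritical point [f] has
   a continuous inverse, so that [L] is an arc there, parametrized by the argument
   of [f]. Starting from a noncritical point, continue the solution [g] of
   [f (g u) = eps e^(i u)] along [L] as far as possible. If the domain of [u] is
   unbounded, finiteness of the fibers makes [g] periodic; its image is then open and
   closed in [L], hence is all of [L]. If the domain is [(a, b)], then [g] has limits
   [v], [w] at its ends, which are critical points, and the midpoint [q] of this edge
   satisfies [f q ^ 2 = f v * f w]; so there are finitely many midpoints, hence
   finitely many edges. *)

(** The branches of [L] at a critical point are never analysed: writing a zero of order [m + 1] as
    crossing arcs would need a holomorphic root. Critical points enter only as a finite set, and the
    ends of edges are found by compactness, isolated fibers turning a cluster point into a limit.
    The price is that vertex degrees stay unknown, so the number of edges has to be bounded through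
    the midpoints instead. In the same spirit [G] is only shown to be Lipschitz; this already
    separates zeros and critical points and spares differentiation under the integral. Squares are
    used because their sides reduce contour integrals to real integrals, and the constant [2 i pi]
    is replaced by the transform of [1], by which the expansion is divided. The norm of [Cplx R] is
    itself complex-valued; [cmod] and the epsilon-delta notions below bring all estimates into the
    ordered field [R]. *)

Definition cmod (R : realType) (z : Cplx R) : R := ComplexField.Normc.normc z.
Definition cre (R : realType) (z : Cplx R) : R := complex.Re z.
Definition cim (R : realType) (z : Cplx R) : R := complex.Im z.
Definition cpx (R : realType) (x y : R) : Cplx R := Complex x y.

(** * Complex numbers with a real-valued modulus *)

Lemma addrKC (V : zmodType) (x y : V) : x + y - x = y.
Proof. by rewrite addrAC subrr add0r. Qed.

Section Modulus.
Variable R : realType.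
Notation C := (Cplx R).
Implicit Types (z w : C) (x y r : R).

Lemma normC z : `|z| = (cmod z)%:C%C :> C.
Proof. by case: z. Qed.

Lemma cmodE z : cmod z = Num.sqrt (cre z ^+ 2 + cim z ^+ 2).
Proof. by case: z. Qed.

Lemma cpxE z : cpx (cre z) (cim z) = z. Proof. by case: z. Qed.
Lemma creE x y : cre (cpx x y) = x. Proof. by []. Qed.
Lemma cimE x y : cim (cpx x y) = y. Proof. by []. Qed.
Lemma creD z w : cre (z + w) = cre z + cre w. Proof. by case: z; case: w. Qed.
Lemma cimD z w : cim (z + w) = cim z + cim w. Proof. by case: z; case: w. Qed.
Lemma creN z : cre (- z) = - cre z. Proof. by case: z. Qed.
Lemma cimN z : cim (- z) = - cim z. Proof. by case: z. Qed.
Lemma creB z w : cre (z - w) = cre z - cre w. Proof. by rewrite creD creN. Qed.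
Lemma cimB z w : cim (z - w) = cim z - cim w. Proof. by rewrite cimD cimN. Qed.
Lemma creM z w : cre (z * w) = cre z * cre w - cim z * cim w.
Proof. by case: z; case: w. Qed.
Lemma cimM z w : cim (z * w) = cre z * cim w + cim z * cre w.
Proof. by case: z; case: w. Qed.
Lemma cre0 : cre (0 : C) = 0. Proof. by []. Qed.
Lemma cim0 : cim (0 : C) = 0. Proof. by []. Qed.
Lemma cre1 : cre (1 : C) = 1. Proof. by []. Qed.
Lemma cim1 : cim (1 : C) = 0. Proof. by []. Qed.
Lemma cpx_ext z w : cre z = cre w -> cim z = cim w -> z = w.
Proof. by case: z => a b; case: w => c d /= -> ->. Qed.

Lemma cmod_ge0 z : 0 <= cmod z. Proof. by rewrite cmodE sqrtr_ge0. Qed.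
Lemma cmodM z w : cmod (z * w) = cmod z * cmod w.
Proof. exact: ComplexField.Normc.normcM. Qed.
Lemma cmodV z : cmod z^-1 = (cmod z)^-1.
Proof. exact: ComplexField.Normc.normcV. Qed.
Lemma cmod1 : cmod (1 : C) = 1. Proof. exact: ComplexField.Normc.normc1. Qed.
Lemma cmod0 : cmod (0 : C) = 0. Proof. exact: ComplexField.Normc.normc0. Qed.
Lemma cmodN z : cmod (- z) = cmod z. Proof. exact: normcN. Qed.
Lemma cmodB z w : cmod (z - w) = cmod (w - z).
Proof. by rewrite -cmodN opprB. Qed.
Lemma cmodD z w : cmod (z + w) <= cmod z + cmod w.
Proof. exact: le_normcD. Qed.
Lemma cmodX z n : cmod (z ^+ n) = cmod z ^+ n.
Proof. by elim: n => [|n ih]; rewrite ?expr0 ?cmod1 // !exprS cmodM ih. Qed.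
Lemma cmod_eq0 z : (cmod z == 0) = (z == 0).
Proof.
apply/eqP/eqP => [|->]; last exact: cmod0.
exact: ComplexField.Normc.eq0_normc.
Qed.
Lemma cmod_gt0 z : (0 < cmod z) = (z != 0).
Proof. by rewrite lt_neqAle cmod_ge0 andbT eq_sym cmod_eq0. Qed.

Lemma cmod_tri z u w : cmod (z - w) <= cmod (z - u) + cmod (u - w).
Proof. by rewrite (_ : z - w = (z - u) + (u - w)); [exact: cmodD|ring]. Qed.

Lemma cmodB_ge z w : cmod z - cmod w <= cmod (z - w).
Proof.
have := cmodD (z - w) w; rewrite subrK; lra.
Qed.

Lemma cmodD_ge z w : cmod z - cmod w <= cmod (z + w).
Proof. by have := cmodB_ge z (- w); rewrite opprK cmodN. Qed.

Lemma cre_le z : `|cre z| <= cmod z.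
Proof. by rewrite cmodE -sqrtr_sqr; apply: ler_wsqrtr; rewrite lerDl sqr_ge0. Qed.
Lemma cim_le z : `|cim z| <= cmod z.
Proof. by rewrite cmodE -sqrtr_sqr; apply: ler_wsqrtr; rewrite lerDr sqr_ge0. Qed.

Lemma cmod_real x : cmod (x%:C%C : C) = `|x|.
Proof. by rewrite cmodE /= expr0n addr0 sqrtr_sqr. Qed.

Lemma cmod_im y : cmod (cpx 0 y) = `|y|.
Proof. by rewrite cmodE /= expr0n add0r sqrtr_sqr. Qed.

Lemma cmod_le z : cmod z <= `|cre z| + `|cim z|.
Proof.
have -> : z = (cre z)%:C%C + cpx 0 (cim z).
  by apply: cpx_ext; rewrite ?creD ?cimD ?creE ?cimE /= ?addr0 ?add0r.
rewrite (le_trans (cmodD _ _)) // cmod_real cmod_im.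
by rewrite !creD !cimD /= !addr0 !add0r.
Qed.

Lemma cmod_max z r : `|cre z| <= r -> `|cim z| <= r -> cmod z <= 2 * r.
Proof. by have := cmod_le z; lra. Qed.

Lemma cmod_ltr_real (e : C) : 0 < e -> exists2 r : R, 0 < r & e = r%:C%C.
Proof.
case: e => a b; rewrite ltcE /= => /andP[/eqP b0 a0].
by exists a => //; rewrite b0.
Qed.

Lemma ball_cmod z r w : ball z (r%:C%C : C) w <-> cmod (w - z) < r.
Proof. by rewrite -ball_normE /ball_ /= normC ltcR cmodB. Qed.

Lemma nbhs_cmod z (A : set C) :
  nbhs z A <-> exists2 d : R, 0 < d & forall w, cmod (w - z) < d -> A w.
Proof.
rewrite nbhs_ballP; split => [[e /= /cmod_ltr_real[r r0 ->] h]|[d d0 h]].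
  by exists r => // w /ball_cmod; exact: h.
by exists d%:C%C; [rewrite /= ltcR|move=> w /ball_cmod; exact: h].
Qed.

Lemma nbhs'_cmod z (A : set C) :
  nbhs z^' A <->
  exists2 d : R, 0 < d & forall w, cmod (w - z) < d -> w != z -> A w.
Proof. exact: nbhs_cmod. Qed.

Lemma open_cmod (A : set C) z : open A -> A z ->
  exists2 d : R, 0 < d & forall w, cmod (w - z) < d -> A w.
Proof. by move=> oA Az; apply/nbhs_cmod; exact: open_nbhs_nbhs. Qed.

Definition ccont (f : C -> C) z := forall e : R, 0 < e ->
  exists2 d : R, 0 < d & forall w, cmod (w - z) < d -> cmod (f w - f z) < e.

Lemma cvg_cmod {T} (F : set_system T) {FF : Filter F} (f : T -> C) l :
  f @ F --> l <-> forall e : R, 0 < e -> \forall t \near F, cmod (f t - l) < e.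
Proof.
split=> [fl e e0|h].
  by have /fl : nbhs l [set w | cmod (w - l) < e] by apply/nbhs_cmod; exists e.
move=> A /nbhs_cmod[d d0 hd]; rewrite nbhs_filterE /=.
by apply: filterS (h _ d0) => t; exact: hd.
Qed.

Lemma ccontP (f : C -> C) z : {for z, continuous f} <-> ccont f z.
Proof.
split=> [/cvg_cmod h e e0|h]; first by have /nbhs_cmod := h _ e0.
apply: (@cvg_cmod _ (nbhs z) _ f (f z)).2 => e e0.
by apply/nbhs_cmod; exact: h.
Qed.

Lemma ccont_cst (k : C) z : ccont (fun=> k) z.
Proof. by move=> e e0; exists 1 => // w _; rewrite subrr cmod0. Qed.

Lemma ccont_id z : ccont id z.
Proof. by move=> e e0; exists e. Qed.

Lemma ccontD (f g : C -> C) z : ccont f z -> ccont g z ->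
  ccont (fun w => f w + g w) z.
Proof.
move=> /ccontP cf /ccontP cg; apply/ccontP.
exact: (@cvgD C C C (nbhs z) (nbhs_filter z) f g (f z) (g z) cf cg).
Qed.

Lemma ccontB (f g : C -> C) z : ccont f z -> ccont g z ->
  ccont (fun w => f w - g w) z.
Proof.
move=> /ccontP cf /ccontP cg; apply/ccontP.
exact: (@cvgB C C C (nbhs z) (nbhs_filter z) f g (f z) (g z) cf cg).
Qed.

Lemma ccontM (f g : C -> C) z : ccont f z -> ccont g z ->
  ccont (fun w => f w * g w) z.
Proof.
move=> /ccontP cf /ccontP cg; apply/ccontP.
exact: (@cvgM C C (nbhs z) (nbhs_filter z) f g (f z) (g z) cf cg).
Qed.

Lemma ccontV (f : C -> C) z : f z != 0 -> ccont f z ->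
  ccont (fun w => (f w)^-1) z.
Proof.
move=> f0 /ccontP cf; apply/ccontP.
exact: (@cvgV C C (nbhs z) (nbhs_filter z) f (f z) f0 cf).
Qed.

(** The difference quotient is multiplied out, with a non-strict bound: no division occurs, and
    [w = z] is a harmless case. *)
Definition cder (f : C -> C) z (c : C) := forall e : R, 0 < e ->
  exists2 d : R, 0 < d & forall w, cmod (w - z) < d ->
    cmod (f w - f z - c * (w - z)) <= e * cmod (w - z).

Lemma cder_cvg (f : C -> C) z c : cder f z c <->
  h^-1 *: (f (h + z) - f z) @[h --> 0^'] --> c.
Proof.
split=> [h|/cvg_cmod h e e0].
  apply: (@cvg_cmod C (dnbhs (0 : C)) (dnbhs_filter _)
    (fun h => h^-1 *: (f (h + z) - f z)) c).2 => e e0.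
  have [d d0 hd] := h _ (divr_gt0 e0 (ltr0n R 2)).
  apply/nbhs'_cmod; exists d => // w; rewrite subr0 => wd w0.
  have := hd (w + z); rewrite addrK => /(_ wd) hw.
  have -> : (w^-1 *: (f (w + z) - f z) - c) = w^-1 * (f (w + z) - f z - c * w).
    by rewrite /GRing.scale /=; field.
  rewrite cmodM cmodV mulrC ltr_pdivrMr ?cmod_gt0 //.
  apply: (le_lt_trans hw); rewrite ltr_pM2r ?cmod_gt0 //; lra.
have /nbhs'_cmod[d d0 hd] := h _ e0; exists d => // w wd.
have [->|wz] := eqVneq w z; first by rewrite !subrr mulr0 subr0 cmod0 mulr0.
have wz' : w - z != 0 by rewrite subr_eq0.
have := hd (w - z); rewrite subr0 subrK => /(_ wd wz') hw.
have E : f w - f z - c * (w - z) = ((w - z)^-1 *: (f w - f z) - c) * (w - z).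
  by rewrite /GRing.scale /=; field.
by rewrite E cmodM ler_wpM2r ?cmod_ge0 // ltW.
Qed.

Lemma derivable_cder (f : C -> C) z :
  derivable f z 1 <-> exists c, cder f z c.
Proof.
have E : (fun h : C => h^-1 *: ((f \o shift z) (h *: (1 : C)) - f z)) =
    (fun h => h^-1 *: (f (h + z) - f z)).
  by apply/funext => h; rewrite /= /GRing.scale /= mulr1.
rewrite /derivable E; split=> [/cvg_ex[/= c hc]|[c hc]].
  by exists c; exact/cder_cvg.
by apply/cvg_ex; exists c; exact/cder_cvg.
Qed.

Lemma cder_derive1 (f : C -> C) z c : cder f z c -> derive1 f z = c.
Proof.
by move=> /cder_cvg h; apply: cvg_lim => //; exact: norm_hausdorff.
Qed.

Lemma cder_cont (f : C -> C) z c : cder f z c -> ccont f z.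
Proof.
move=> h e e0; have [d d0 hd] := h 1 ltr01.
have K0 : 0 < 1 + cmod c by have := cmod_ge0 c; lra.
exists (Num.min d (e / (1 + cmod c))); first by rewrite lt_min d0 divr_gt0.
move=> w; rewrite lt_min => /andP[/hd hw]; rewrite ltr_pdivlMr // => we.
have -> : f w - f z = (f w - f z - c * (w - z)) + c * (w - z) by ring.
have := cmodD (f w - f z - c * (w - z)) (c * (w - z)).
rewrite cmodM; nra.
Qed.

End Modulus.

(** * Contour integrals and Goursat's theorem *)

Section RealIntegral.
Variable R : realType.
Implicit Types (g h : R -> R) (a b c t M : R).

Definition rint a b g : R := (\int[lebesgue_measure]_(x in `[a, b]) g x)%R.

(** Continuity is two-sided even at [a] and [b], which avoids subspace topologies; the integrands
    used are continuous around the points of the contour. *)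
Definition rcont a b g := forall t, a <= t <= b -> {for t, continuous g}.

Lemma rcont_integrable a b g : rcont a b g ->
  (@lebesgue_measure R).-integrable `[a, b] (EFin \o g).
Proof.
move=> cg; apply: continuous_compact_integrable; first exact: segment_compact.
apply: continuous_in_subspaceT => t /set_mem /= tab; apply: cg.
by move: tab; rewrite in_itv.
Qed.

Lemma rintB a b g h : rcont a b g -> rcont a b h ->
  rint a b (fun t => g t - h t) = rint a b g - rint a b h.
Proof.
by move=> cg ch; rewrite /rint RintegralB //; exact: rcont_integrable.
Qed.

Lemma rintD a b g h : rcont a b g -> rcont a b h ->
  rint a b (fun t => g t + h t) = rint a b g + rint a b h.
Proof.
by move=> cg ch; rewrite /rint RintegralD //; exact: rcont_integrable.
Qed.

Lemma rintZ a b g c : rcont a b g ->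
  rint a b (fun t => c * g t) = c * rint a b g.
Proof. by move=> cg; rewrite /rint RintegralZl //; exact: rcont_integrable. Qed.

Lemma rint_cst a b c : a <= b -> rint a b (fun=> c) = c * (b - a).
Proof.
move=> ab; rewrite /rint Rintegral_cst //= lebesgue_measure_itv /= lte_fin.
case: ltP => // ba.
by rewrite (le_anti (introT andP (conj ab ba))) subrr.
Qed.

Lemma rint_le a b g h : rcont a b g -> rcont a b h ->
  (forall t, a <= t <= b -> g t <= h t) -> rint a b g <= rint a b h.
Proof.
move=> cg ch gh; apply: le_Rintegral => //; try exact: rcont_integrable.
Qed.

Lemma rint_abs a b g M : a <= b -> rcont a b g ->
  (forall t, a <= t <= b -> `|g t| <= M) -> `|rint a b g| <= M * (b - a).
Proof.
have cst c : rcont a b (fun=> c) by move=> t _; exact: cst_continuous.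
move=> ab cg gM; rewrite ler_norml; apply/andP; split.
  rewrite -mulNr -rint_cst //; apply: rint_le => // t /gM.
  by rewrite ler_norml => /andP[].
rewrite -rint_cst //; apply: rint_le => // t /gM.
by rewrite ler_norml => /andP[].
Qed.

Lemma rint_cat a b c g : a <= b -> b <= c -> rcont a c g ->
  rint a c g = rint a b g + rint b c g.
Proof.
move=> ab bc cg; have ig := rcont_integrable cg.
have := @Rintegral_itvB R g (BLeft a) (BRight c) b ig.
rewrite !bnd_simp => /(_ ab bc).
rewrite Rintegral_itv_obnd_cbnd => [|]; first by rewrite /rint => <-; ring.
by apply: integrableS ig => //; apply: subset_itvr; rewrite bnd_simp.
Qed.

End RealIntegral.

Section ComplexIntegral.
Variable R : realType.
Notation C := (Cplx R).
Implicit Types (g h : R -> C) (a b c : R).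

Definition pcont g t := forall e : R, 0 < e ->
  exists2 d : R, 0 < d & forall s, `|s - t| < d -> cmod (g s - g t) < e.

Lemma pcontP g t : {for t, continuous g} <-> pcont g t.
Proof.
split=> [/cvg_cmod h e e0|h].
  have /nbhs_ballP[d /= d0 hd] := h _ e0.
  by exists d => // s st; apply: hd; rewrite /ball /= distrC.
apply: (@cvg_cmod R R (nbhs t) (nbhs_filter t) g (g t)).2 => e e0.
have [d d0 hd] := h _ e0; apply/nbhs_ballP; exists d => // s.
by rewrite /ball /= distrC; exact: hd.
Qed.

Lemma rcontinuousP (g : R -> R) t : {for t, continuous g} <->
  forall e : R, 0 < e ->
  exists2 d : R, 0 < d & forall s, `|s - t| < d -> `|g s - g t| < e.
Proof.
split=> [/cvgrPdist_lt h e e0|h].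
  have /nbhs_ballP[d /= d0 hd] := h _ e0.
  by exists d => // s st; rewrite distrC; apply: hd; rewrite /ball /= distrC.
apply/cvgrPdist_lt => e e0; have [d d0 hd] := h _ e0.
apply/nbhs_ballP; exists d => // s.
by rewrite /ball /= distrC => /hd; rewrite distrC.
Qed.

Lemma pcont_re g t : pcont g t -> {for t, continuous (fun s => cre (g s))}.
Proof.
move=> h; apply/rcontinuousP => e /h[d d0 hd]; exists d => // s /hd.
by apply: le_lt_trans; rewrite -creB cre_le.
Qed.

Lemma pcont_im g t : pcont g t -> {for t, continuous (fun s => cim (g s))}.
Proof.
move=> h; apply/rcontinuousP => e /h[d d0 hd]; exists d => // s /hd.
by apply: le_lt_trans; rewrite -cimB cim_le.
Qed.

Lemma pcont_comp (f : C -> C) g t : ccont f (g t) -> pcont g t ->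
  pcont (fun s => f (g s)) t.
Proof.
move=> cf cg e /cf[d d0 hd]; have [d' d'0 hd'] := cg _ d0.
by exists d' => // s /hd'; exact: hd.
Qed.

Definition pconton a b g := forall t, a <= t <= b -> pcont g t.

Definition cint a b g : C :=
  cpx (rint a b (fun t => cre (g t))) (rint a b (fun t => cim (g t))).

Lemma eq_cint a b g h : (forall t, a <= t <= b -> g t = h t) ->
  cint a b g = cint a b h.
Proof.
move=> gh; rewrite /cint /rint; congr cpx; apply: eq_Rintegral => t /set_mem /=;
  by rewrite in_itv => /gh ->.
Qed.

Lemma cintB a b g h : pconton a b g -> pconton a b h ->
  cint a b (fun t => g t - h t) = cint a b g - cint a b h.
Proof.
move=> cg ch; apply: cpx_ext; rewrite ?creB ?cimB ?creE ?cimE -rintB;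
  try by move=> t tab; (apply/pcont_re || apply/pcont_im); auto.
  by apply: eq_Rintegral => t _; rewrite creB.
by apply: eq_Rintegral => t _; rewrite cimB.
Qed.

Lemma cintZ a b g k : pconton a b g ->
  cint a b (fun t => k * g t) = k * cint a b g.
Proof.
move=> cg.
have cr : rcont a b (fun t => cre (g t)) by move=> t /cg; exact: pcont_re.
have ci : rcont a b (fun t => cim (g t)) by move=> t /cg; exact: pcont_im.
have cm (u : R -> R) x : rcont a b u -> rcont a b (fun t => x * u t).
  by move=> cu t /cu cut; apply: continuousM => //; exact: cst_continuous.
apply: cpx_ext; rewrite ?creM ?cimM ?creE ?cimE -!rintZ //.
  rewrite -rintB; try exact: cm.
  by apply: eq_Rintegral => t _; rewrite creM.
rewrite -rintD; try exact: cm.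
by apply: eq_Rintegral => t _; rewrite cimM.
Qed.

Lemma cint_cst a b (k : C) : a <= b -> cint a b (fun=> k) = k * (b - a)%:C%C.
Proof.
move=> ab; rewrite /cint !rint_cst //.
by apply: cpx_ext; rewrite ?creM ?cimM ?creE ?cimE /= mulr0 ?subr0 ?add0r.
Qed.

Lemma cint_cat a b c g : a <= b -> b <= c -> pconton a c g ->
  cint a c g = cint a b g + cint b c g.
Proof.
move=> ab bc cg.
by rewrite /cint !(@rint_cat _ a b c) // => t /cg; [exact: pcont_im|exact: pcont_re].
Qed.

Lemma cint_le a b g (M : R) : a <= b -> pconton a b g ->
  (forall t, a <= t <= b -> cmod (g t) <= M) ->
  cmod (cint a b g) <= 2 * (M * (b - a)).
Proof.
move=> ab cg gM; apply: cmod_max; rewrite ?creE ?cimE; apply: rint_abs => //.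
- by move=> t /cg; exact: pcont_re.
- by move=> t /gM; apply: le_trans; exact: cre_le.
- by move=> t /cg; exact: pcont_im.
- by move=> t /gM; apply: le_trans; exact: cim_le.
Qed.

End ComplexIntegral.

(** * Integrals along the boundary of a rectangle, and Goursat's theorem *)

Section Rectangle.
Variable R : realType.
Notation C := (Cplx R).
Implicit Types (F G : C -> C) (a b c d w h : R).

Lemma pcont_h (y t : R) : pcont (fun s => cpx s y) t.
Proof.
move=> e e0; exists e => // s st.
rewrite /cmod /=; rewrite subrr expr0n addr0 sqrtr_sqr //.
Qed.

Lemma pcont_v (x t : R) : pcont (fun s => cpx x s) t.
Proof.
move=> e e0; exists e => // s st.
rewrite /cmod /=; rewrite subrr expr0n add0r sqrtr_sqr //.
Qed.

(** The counterclockwise contour integral: bottom minus top with [dz = dt], then right minus left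
    with [dz = i dt]. *)
Definition rectint F a b c d : C :=
  cint a b (fun t => F (cpx t c)) - cint a b (fun t => F (cpx t d)) +
  cpx 0 1 * (cint c d (fun t => F (cpx b t)) - cint c d (fun t => F (cpx a t))).

Definition inrect a b c d (z : C) := a <= cre z <= b /\ c <= cim z <= d.

(** Only boundary points are constrained, since Cauchy kernels are singular inside. *)
Definition rectcont F a b c d :=
  a <= b /\ c <= d /\
  [/\ forall t, a <= t <= b -> ccont F (cpx t c),
      forall t, a <= t <= b -> ccont F (cpx t d),
      forall t, c <= t <= d -> ccont F (cpx a t) &
      forall t, c <= t <= d -> ccont F (cpx b t)].

Lemma inrect_cont F a b c d : a <= b -> c <= d ->
  (forall z, inrect a b c d z -> ccont F z) -> rectcont F a b c d.
Proof.
move=> ab cd h; do 2 split=> //; split=> t /andP[? ?]; apply: h;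
  rewrite /inrect !creE !cimE; split; lra.
Qed.

Lemma pconton_h F a b y :
  (forall t, a <= t <= b -> ccont F (cpx t y)) ->
  pconton a b (fun t => F (cpx t y)).
Proof.
by move=> h t /h cF; apply: (@pcont_comp _ F (fun s => cpx s y)) => //; exact: pcont_h.
Qed.

Lemma pconton_v F c d x :
  (forall t, c <= t <= d -> ccont F (cpx x t)) ->
  pconton c d (fun t => F (cpx x t)).
Proof.
by move=> h t /h cF; apply: (@pcont_comp _ F (fun s => cpx x s)) => //; exact: pcont_v.
Qed.

Lemma rectintB F G a b c d : rectcont F a b c d -> rectcont G a b c d ->
  rectint (fun z => F z - G z) a b c d =
  rectint F a b c d - rectint G a b c d.
Proof.
move=> [ab [cd [F1 F2 F3 F4]]] [_ [_ [G1 G2 G3 G4]]]; rewrite /rectint.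
rewrite !(@cintB _ a b) ?(@cintB _ c d); do ?[exact: pconton_h|exact: pconton_v].
ring.
Qed.

Lemma rectintZ F k a b c d : rectcont F a b c d ->
  rectint (fun z => k * F z) a b c d = k * rectint F a b c d.
Proof.
move=> [ab [cd [F1 F2 F3 F4]]]; rewrite /rectint.
rewrite !(@cintZ _ a b) ?(@cintZ _ c d); do ?[exact: pconton_h|exact: pconton_v].
ring.
Qed.

Lemma eq_rectint F G a b c d :
  (forall z, inrect a b c d z ->
     [|| cre z == a, cre z == b, cim z == c | cim z == d] -> F z = G z) ->
  a <= b -> c <= d -> rectint F a b c d = rectint G a b c d.
Proof.
move=> FG ab cd; rewrite /rectint; congr (_ - _ + _ * (_ - _)); apply: eq_cint;
  move=> t tab; (apply: FG; first (rewrite /inrect !creE !cimE; split; lra));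
  by rewrite ?creE ?cimE eqxx ?orbT.
Qed.

Lemma rectint_cat_h F a b b' c d : a <= b -> b <= b' -> c <= d ->
  (forall z, inrect a b' c d z -> ccont F z) ->
  rectint F a b' c d = rectint F a b c d + rectint F b b' c d.
Proof.
move=> ab bb cd cF; have ab' := le_trans ab bb.
have [_ [_ [F1 F2 F3 F4]]] := inrect_cont ab' cd cF.
rewrite /rectint !(@cint_cat _ a b b') //; try exact: pconton_h.
by ring.
Qed.

Lemma rectint_cat_v F a b c d d' : a <= b -> c <= d -> d <= d' ->
  (forall z, inrect a b c d' z -> ccont F z) ->
  rectint F a b c d' = rectint F a b c d + rectint F a b d d'.
Proof.
move=> ab cd dd cF; have cd' := le_trans cd dd.
have [_ [_ [F1 F2 F3 F4]]] := inrect_cont ab cd' cF.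
rewrite /rectint !(@cint_cat _ c d d') //; try exact: pconton_v.
by ring.
Qed.

Lemma ccont_affine (p q : C) z : ccont (fun z => p + q * z) z.
Proof.
by apply: ccontD; [exact: ccont_cst|apply: ccontM; [exact: ccont_cst|exact: ccont_id]].
Qed.

Lemma rectint_affine (p q : C) a b c d : a <= b -> c <= d ->
  rectint (fun z => p + q * z) a b c d = 0.
Proof.
move=> ab cd; rewrite /rectint.
have cA z := @ccont_affine p q z.
have ch y : pconton a b (fun t => p + q * cpx t y).
  exact: (@pconton_h (fun z => p + q * z)).
have cv x : pconton c d (fun t => p + q * cpx x t).
  exact: (@pconton_v (fun z => p + q * z)).
rewrite -(cintB (ch _) (ch _)) -(cintB (cv _) (cv _)).
rewrite (@eq_cint _ a b _ (fun=> q * cpx 0 (c - d))); last first.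
  by move=> t _; rewrite opprD addrACA subrr add0r -mulrBr; congr (_ * _);
    apply: cpx_ext; rewrite ?creB ?cimB ?creE ?cimE ?subrr.
rewrite (@eq_cint _ c d _ (fun=> q * cpx (b - a) 0)); last first.
  by move=> t _; rewrite opprD addrACA subrr add0r -mulrBr; congr (_ * _);
    apply: cpx_ext; rewrite ?creB ?cimB ?creE ?cimE ?subrr.
rewrite !cint_cst //.
by apply: cpx_ext; rewrite ?(creD, cimD, creM, cimM, creE, cimE, cre0, cim0) /=; ring.
Qed.

Lemma rectint_le F a b c d (M : R) : rectcont F a b c d ->
  (forall z, inrect a b c d z ->
     [|| cre z == a, cre z == b, cim z == c | cim z == d] -> cmod (F z) <= M) ->
  cmod (rectint F a b c d) <= 4 * (M * ((b - a) + (d - c))).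
Proof.
move=> [ab [cd [F1 F2 F3 F4]]] FM.
have B1 y : (y == c) || (y == d) -> (forall t, a <= t <= b -> ccont F (cpx t y)) ->
    cmod (cint a b (fun t => F (cpx t y))) <= 2 * (M * (b - a)).
  move=> ycd cF; apply: cint_le => //; first exact: pconton_h.
  move=> t tab; apply: FM; last by rewrite !cimE ycd !orbT.
  by rewrite /inrect !creE !cimE; split=> //; case/orP: ycd => /eqP ->; lra.
have B2 x : (x == a) || (x == b) -> (forall t, c <= t <= d -> ccont F (cpx x t)) ->
    cmod (cint c d (fun t => F (cpx x t))) <= 2 * (M * (d - c)).
  move=> xab cF; apply: cint_le => //; first exact: pconton_v.
  move=> t tab; apply: FM; last by rewrite !creE orbA xab.
  by rewrite /inrect !creE !cimE; split=> //; case/orP: xab => /eqP ->; lra.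
have := B1 c; have := B1 d; have := B2 a; have := B2 b.
rewrite !eqxx ?orbT => /(_ isT F4) h4 /(_ isT F3) h3 /(_ isT F2) h2 /(_ isT F1) h1.
rewrite /rectint; apply: (le_trans (cmodD _ _)).
rewrite cmodM cmod_im normr1 mul1r.
have := cmodD (cint a b (fun t => F (cpx t c))) (- cint a b (fun t => F (cpx t d))).
have := cmodD (cint c d (fun t => F (cpx b t))) (- cint c d (fun t => F (cpx a t))).
rewrite !cmodN; lra.
Qed.

(** The intervals from [u n] to [u n + w / 2 ^+ n] are nested, and [p] is the supremum of their left
    ends. This serves each coordinate of the shrinking rectangles in Goursat's theorem. *)
Lemma nested_limit (u : nat -> R) w : 0 <= w ->
  (forall n, u n <= u n.+1 <= u n + w / 2 ^+ n.+1) ->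
  exists p, forall n, u n <= p <= u n + w / 2 ^+ n.
Proof.
move=> w0 hu.
have pow n : w / 2 ^+ n = 2 * (w / 2 ^+ n.+1).
  by rewrite exprS; field; rewrite expf_neq0 ?pnatr_eq0.
have u_le n k : u n <= u (n + k)%N.
  elim: k => [|k ih]; first by rewrite addn0.
  by rewrite addnS; case/andP: (hu (n + k)%N) => h _; exact: le_trans h.
have v_le n k : u (n + k)%N + w / 2 ^+ (n + k) <= u n + w / 2 ^+ n.
  elim: k => [|k ih]; first by rewrite addn0.
  rewrite addnS; apply: le_trans ih; have := hu (n + k)%N.
  by rewrite (pow (n + k)%N); lra.
have wn n : 0 <= w / 2 ^+ n by rewrite divr_ge0 // exprn_ge0.
have uv n m : u m <= u n + w / 2 ^+ n.
  have [mn|nm] := leqP m n.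
    rewrite -(subnKC mn); have := u_le m (n - m)%N; have := wn (m + (n - m))%N; lra.
  have := v_le n (m - n)%N; rewrite (subnKC (ltnW nm)); have := wn m; lra.
exists (sup (range u)) => n; apply/andP; split.
  apply: ub_le_sup; last by exists n.
  by exists (u 0%N + w / 2 ^+ 0) => _ [m _ <-].
apply: ge_sup; first by exists (u 0%N); exists 0%N.
by move=> _ [m _ <-].
Qed.

Lemma half_pow_lt (w e : R) : 0 < e -> exists n, w / 2 ^+ n < e.
Proof.
move=> e0; exists (Num.truncn `|w / e|).+1.
have n2 k : k%:R < (2 ^+ k : R) by rewrite -natrX ltr_nat ltn_expl.
rewrite ltr_pdivrMr ?exprn_gt0 // mulrC -ltr_pdivrMr //.
by apply: le_lt_trans (ler_norm _) (lt_trans _ (n2 _)); exact: truncnS_gt.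
Qed.

(** The integral is the sum over the four quarters, so one quarter carries at least a fourth of its
    modulus; [q] is the lower left corner of that quarter. *)
Lemma quad_step F a c w h : 0 <= w -> 0 <= h ->
  (forall z, inrect a (a + w) c (c + h) z -> ccont F z) ->
  exists q : R * R, [/\ a <= q.1 <= a + w / 2, c <= q.2 <= c + h / 2 &
    cmod (rectint F a (a + w) c (c + h)) <=
    4 * cmod (rectint F q.1 (q.1 + w / 2) q.2 (q.2 + h / 2))].
Proof.
move=> w0 h0 cF.
pose r x y := rectint F x (x + w / 2) y (y + h / 2).
have E : rectint F a (a + w) c (c + h) =
    (r a c + r a (c + h / 2)) + (r (a + w / 2) c + r (a + w / 2) (c + h / 2)).
  rewrite (@rectint_cat_h F a (a + w / 2)); [|lra|lra|lra|exact: cF].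
  rewrite (@rectint_cat_v F a (a + w / 2) c (c + h / 2)); [|lra|lra|lra|]; last first.
    by move=> z [? ?]; apply: cF; split; lra.
  rewrite (@rectint_cat_v F (a + w / 2) (a + w) c (c + h / 2)); [|lra|lra|lra|]; last first.
    by move=> z [? ?]; apply: cF; split; lra.
  have hE (x : R) : x / 2 + x / 2 = x by lra.
  by rewrite /r -!addrA !hE.
have nw : a <= a <= a + w / 2 by rewrite lexx lerDl divr_ge0.
have ne : a <= a + w / 2 <= a + w / 2 by rewrite lexx lerDl divr_ge0.
have sw : c <= c <= c + h / 2 by rewrite lexx lerDl divr_ge0.
have se : c <= c + h / 2 <= c + h / 2 by rewrite lexx lerDl divr_ge0.
apply: contrapT => nq.
set K := cmod _ in nq.
have nr x y : a <= x <= a + w / 2 -> c <= y <= c + h / 2 -> 4 * cmod (r x y) < K.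
  move=> xa yc; rewrite ltNge; apply/negP => Kr; apply: nq; exists (x, y).
  by split.
have : K <= cmod (r a c) + cmod (r a (c + h / 2)) +
    (cmod (r (a + w / 2) c) + cmod (r (a + w / 2) (c + h / 2))).
  by rewrite /K E; apply: (le_trans (cmodD _ _)); apply: lerD; exact: cmodD.
move: (nr _ _ nw sw) (nr _ _ nw se) (nr _ _ ne sw) (nr _ _ ne se).
clear nq nr; clearbody K.
move: (cmod _) (cmod _) (cmod _) (cmod _) => r1 r2 r3 r4.
clear; lra.
Qed.

(** Repeated quartering closes in on a point where [F] agrees with an affine map up to a small
    multiple of the distance; the affine part integrates to zero. *)
Lemma goursat F a b c d : a <= b -> c <= d ->
  (forall z, inrect a b c d z -> exists k, cder F z k) ->
  rectint F a b c d = 0.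
Proof.
move=> ab cd dF.
have cF z : inrect a b c d z -> ccont F z by move=> /dF[k]; exact: cder_cont.
pose w := b - a; pose h := d - c.
have w0 : 0 <= w by rewrite /w; lra.
have h0 : 0 <= h by rewrite /h; lra.
have Eb : a + w = b by rewrite /w; lra.
have Ed : c + h = d by rewrite /h; lra.
pose wn n := w / 2 ^+ n; pose hn n := h / 2 ^+ n.
have wn0 n : 0 <= wn n by rewrite divr_ge0 // exprn_ge0.
have hn0 n : 0 <= hn n by rewrite divr_ge0 // exprn_ge0.
have wnS n : wn n.+1 = wn n / 2.
  by rewrite /wn exprSr; field; rewrite expf_neq0 ?pnatr_eq0.
have hnS n : hn n.+1 = hn n / 2.
  by rewrite /hn exprSr; field; rewrite expf_neq0 ?pnatr_eq0.
pose I (n : nat) (p : R * R) := [/\ a <= p.1, p.1 + wn n <= b, c <= p.2 & p.2 + hn n <= d].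
(* Guarding the step by [I n p] lets [choice] produce a step function that is total on pairs. *)
pose J n (p q : R * R) := I n p -> [/\ p.1 <= q.1 <= p.1 + wn n.+1,
    p.2 <= q.2 <= p.2 + hn n.+1 &
    cmod (rectint F p.1 (p.1 + wn n) p.2 (p.2 + hn n)) <=
    4 * cmod (rectint F q.1 (q.1 + wn n.+1) q.2 (q.2 + hn n.+1))].
have /choice[st hst] (np : nat * (R * R)) : exists q, J np.1 np.2 q.
  case: np => n p /=.
  have [[I1 I2 I3 I4]|nI] := pselect (I n p); last by exists p.
  have [|q [q1 q2 q3]] := @quad_step F p.1 p.2 _ _ (wn0 n) (hn0 n).
    by move=> z [? ?]; apply: cF; split; lra.
  by exists q => _; rewrite wnS hnS.
pose u := fix u n := if n is m.+1 then st (m, u m) else (a, c).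
have Iu n : I n (u n).
  elim: n => [|n ih]; first by rewrite /I /wn /hn expr0 !divr1 /= Eb Ed; split.
  have [u1 u2 _] := hst (n, u n) ih; move: ih => [i1 i2 i3 i4].
  move: u1 u2; rewrite /= wnS hnS => u1 u2.
  by have := wnS n; have := hnS n; split=> /=; lra.
have Ju n := hst (n, u n) (Iu n).
have [p1 hp1] : exists p, forall n, (u n).1 <= p <= (u n).1 + w / 2 ^+ n.
  by apply: nested_limit => // n; case: (Ju n).
have [p2 hp2] : exists p, forall n, (u n).2 <= p <= (u n).2 + h / 2 ^+ n.
  by apply: nested_limit => // n; case: (Ju n).
pose K := cmod (rectint F a b c d).
pose r n := rectint F (u n).1 ((u n).1 + wn n) (u n).2 ((u n).2 + hn n).
have Kn n : K <= 4 ^+ n * cmod (r n).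
  elim: n => [|n ih].
    by rewrite expr0 mul1r /r /wn /hn expr0 !divr1 /= Eb Ed.
  apply: (le_trans ih); rewrite exprSr -mulrA ler_pM2l ?exprn_gt0 //.
  by case: (Ju n).
have [k hk] : exists k, cder F (cpx p1 p2) k.
  apply: dF; have := hp1 0%N; have := hp2 0%N.
  by rewrite expr0 !divr1 /= Eb Ed /inrect creE cimE.
(* Once the [n]-th rectangle lies in the disc given by differentiability, its integral is at most
   [4 * e * (wn n + hn n) ^+ 2]; the two factors [2 ^- n] cancel the [4 ^+ n] of [Kn]. *)
have Kle e : 0 < e -> K <= 4 * e * (w + h) ^+ 2.
  move=> e0; have [del del0 hdel] := hk _ e0.
  have [n hn'] := half_pow_lt (w + h) del0.
  have whn : wn n + hn n < del by rewrite /wn /hn -mulrDl.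
  apply: (le_trans (Kn n)).
  have [i1 i2 i3 i4] := Iu n; have := wn0 n; have := hn0 n => hn0n wn0n.
  have cFn z : inrect (u n).1 ((u n).1 + wn n) (u n).2 ((u n).2 + hn n) z -> ccont F z.
    by move=> [? ?]; apply: cF; split; lra.
  pose A (z : C) := (F (cpx p1 p2) - k * cpx p1 p2) + k * z.
  have rE : r n = rectint (fun z => F z - A z)
      (u n).1 ((u n).1 + wn n) (u n).2 ((u n).2 + hn n).
    rewrite rectintB.
    - by rewrite rectint_affine ?subr0 //; lra.
    - by apply: inrect_cont => //; lra.
    - by apply: inrect_cont => [||z _]; [lra|lra|exact: ccont_affine].
  have : cmod (r n) <= 4 * (e * (wn n + hn n) *
      (((u n).1 + wn n - (u n).1) + ((u n).2 + hn n - (u n).2))).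
    rewrite rE; apply: rectint_le.
      apply: inrect_cont => [||z hz]; [lra|lra|].
      by apply: ccontB; [exact: cFn|exact: ccont_affine].
    move=> z [z1 z2] _.
    have zp : cmod (z - cpx p1 p2) <= wn n + hn n.
      apply: (le_trans (cmod_le _)); rewrite creB cimB !creE !cimE.
      have := hp1 n; have := hp2 n; rewrite -/(wn n) -/(hn n) => q2 q1.
      by apply: lerD; rewrite ler_norml; lra.
    have /hdel : cmod (z - cpx p1 p2) < del by lra.
    have -> : F z - F (cpx p1 p2) - k * (z - cpx p1 p2) = F z - A z.
      by rewrite /A; ring.
    by move=> h1; apply: (le_trans h1); rewrite ler_pM2l.
  have -> : ((u n).1 + wn n - (u n).1) + ((u n).2 + hn n - (u n).2) = wn n + hn n by ring.
  move=> h1; rewrite -[leRHS](_ : 4 ^+ n * (4 * (e * (wn n + hn n) * (wn n + hn n))) = _).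
    by rewrite ler_pM2l // exprn_gt0.
  have -> : 4 ^+ n = (2 ^+ n) ^+ 2 :> R.
    by rewrite -exprM mulnC exprM; congr (_ ^+ n); ring.
  by rewrite /wn /hn -mulrDl; field; rewrite expf_neq0 ?pnatr_eq0.
apply/eqP; rewrite -cmod_eq0 -/K eq_le cmod_ge0 andbT leNgt; apply/negP => K0.
have S0 : 0 <= (w + h) ^+ 2 by rewrite sqr_ge0.
have D0 : 0 < 8 * ((w + h) ^+ 2 + 1) by lra.
(* This choice yields [K <= K / 2]; the [+ 1] keeps the divisor positive for a degenerate
   rectangle. *)
have := Kle _ (divr_gt0 K0 D0).
have -> : 4 * (K / (8 * ((w + h) ^+ 2 + 1))) * (w + h) ^+ 2 =
   K / 2 * ((w + h) ^+ 2 / ((w + h) ^+ 2 + 1)) by field; lra.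
have : (w + h) ^+ 2 / ((w + h) ^+ 2 + 1) <= 1 by rewrite ler_pdivrMr; lra.
nra.
Qed.

End Rectangle.

(** * Cauchy transforms and local expansions *)

Section CauchyTransform.
Variable R : realType.
Notation C := (Cplx R).
Implicit Types (f g : C -> C) (s : R).

Lemma cder_near f g z k (d : R) : 0 < d ->
  (forall w, cmod (w - z) < d -> f w = g w) -> cder f z k -> cder g z k.
Proof.
move=> d0 fg df e e0; have [d' d'0 hd] := df e e0.
exists (Num.min d d'); first by rewrite lt_min d0.
move=> w; rewrite lt_min => /andP[wd wd'].
by rewrite -(fg w wd) -(fg z) ?subrr ?cmod0 //; exact: hd.
Qed.

Lemma cderB_cst f z k c : cder f z k -> cder (fun w => f w - c) z k.
Proof.
move=> df e /df[d d0 hd]; exists d => // w /hd.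
by congr (_ <= _); congr cmod; ring.
Qed.

Lemma cder_shift f z z0 k : cder f (z0 + z) k -> cder (fun w => f (z0 + w)) z k.
Proof.
move=> df e /df[d d0 hd]; exists d => // w wd.
have E : z0 + w - (z0 + z) = w - z by ring.
by have := hd (z0 + w); rewrite E; exact.
Qed.

Lemma cder_div f z w k : z != w -> cder f z k ->
  exists k', cder (fun u => f u * (u - w)^-1) z k'.
Proof.
move=> zw df; apply/derivable_cder.
have {}df : derivable f z 1 by apply/derivable_cder; exists k.
have h1 : derivable (fun u : C => u - w) z 1.
  exact: (@derivableB C C C id (cst w) z 1 (@derivable_id C C z 1)
    (@derivable_cst C C C w z 1)).
have h2 : derivable (fun u : C => (u - w)^-1) z 1.
  by refine (@derivableV _ _ _ _ _ _ h1); rewrite subr_eq0.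
exact: (@derivableM C C f (fun u : C => (u - w)^-1) z 1 df h2).
Qed.

(* The rectangle is shrunk towards [w], where [f] is bounded, by cutting off four
   rectangles on which [f] is holomorphic. *)
Lemma rectint_removable f a b c d w :
  a < cre w < b -> c < cim w < d ->
  (forall z, inrect a b c d z -> ccont f z) ->
  (forall z, inrect a b c d z -> z != w -> exists k, cder f z k) ->
  rectint f a b c d = 0.
Proof.
move=> wab wcd cf df; apply/eqP; rewrite -cmod_eq0.
rewrite eq_le cmod_ge0 andbT leNgt; apply/negP => K0.
have [del del0 hdel] : exists2 d : R, 0 < d &
    forall z, cmod (z - w) < d -> cmod (f z - f w) < 1.
  by apply: cf => //; rewrite /inrect; split; lra.
have M0 : 0 < cmod (f w) + 1 by have := cmod_ge0 (f w); lra.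
set K := cmod _ in K0; set M := _ + 1 in M0.
(* The small square must stay in the rectangle and in the disc where [f] is bounded by [M];
   [K / (32 * M)] brings the bound [4 * (M * (4 * e))] down to [K / 2]. *)
pose e := Num.min (Num.min (del / 4) (K / (32 * M)))
  (Num.min (Num.min (cre w - a) (b - cre w)) (Num.min (cim w - c) (d - cim w))).
have e0 : 0 < e by rewrite !lt_min !divr_gt0 ?mulr_gt0 //; lra.
have [e1 [e2 [e3 [e4 [e5 e6]]]]] : e <= del / 4 /\ e <= K / (32 * M) /\
    a <= cre w - e /\ cre w + e <= b /\ c <= cim w - e /\ cim w + e <= d.
  have : e <= e by []; rewrite {2}/e !le_min.
  by move=> /andP[/andP[-> ->] /andP[/andP[? ?] /andP[? ?]]]; do ?split=> //; lra.
have KE : K = cmod (rectint f (cre w - e) (cre w + e) (cim w - e) (cim w + e)).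
  have zero a' b' c' d' : a' <= b' -> c' <= d' -> a <= a' -> b' <= b ->
      c <= c' -> d' <= d -> ~ inrect a' b' c' d' w -> rectint f a' b' c' d' = 0.
    move=> ab cd aa bb cc dd nw; apply: goursat => // z hz; apply: df.
      by case: hz => ? ?; split; lra.
    by apply/eqP => zw; apply: nw; rewrite -zw.
  rewrite /K.
  rewrite (@rectint_cat_h _ f a (cre w - e)); [|lra|lra|lra|exact: cf].
  rewrite (zero a (cre w - e)) ?add0r; [|lra..|by rewrite /inrect; lra].
  rewrite (@rectint_cat_h _ f _ (cre w + e)); [|lra|lra|lra|]; last first.
    by move=> z [? ?]; apply: cf; split; lra.
  rewrite (zero (cre w + e) b) ?addr0; [|lra..|by rewrite /inrect; lra].
  rewrite (@rectint_cat_v _ f _ _ c (cim w - e)); [|lra|lra|lra|]; last first.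
    by move=> z [? ?]; apply: cf; split; lra.
  rewrite (zero _ _ c (cim w - e)) ?add0r; [|lra..|by rewrite /inrect; lra].
  rewrite (@rectint_cat_v _ f _ _ _ (cim w + e)); [|lra|lra|lra|]; last first.
    by move=> z [? ?]; apply: cf; split; lra.
  by rewrite (zero _ _ (cim w + e) d) ?addr0 //; [lra..|rewrite /inrect; lra].
have : K <= 4 * (M * ((cre w + e - (cre w - e)) + (cim w + e - (cim w - e)))).
  rewrite {1}KE; apply: rectint_le.
    apply: inrect_cont; [lra|lra|].
    by move=> z [? ?]; apply: cf; split; lra.
  move=> z [z1 z2] _.
  have /hdel : cmod (z - w) < del.
    apply: (le_lt_trans (cmod_max (r := e) _ _)); last by lra.
      by rewrite creB ler_norml; lra.
    by rewrite cimB ler_norml; lra.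
  by rewrite /M; have := cmodB_ge (f z) (f w); lra.
move: e2; rewrite ler_pdivlMr ?mulr_gt0 //.
by clear -M0 K0 e0; nra.
Qed.

Definition onsquare s (z : C) := inrect (- s) s (- s) s z /\
  [|| cre z == - s, cre z == s, cim z == - s | cim z == s].

Lemma onsquare_ge s z : 0 < s -> onsquare s z -> s <= cmod z.
Proof.
move=> s0 [_ h]; have := cre_le z; have := cim_le z.
move: h; have sE : `|s| = s by rewrite ger0_norm // ltW.
by case/or4P=> /eqP ->; rewrite ?normrN sE.
Qed.

Lemma onsquare_dist s z w : 0 < s -> cmod w <= s / 2 -> onsquare s z ->
  s / 2 <= cmod (z - w).
Proof.
by move=> s0 ws /(onsquare_ge s0); have := cmodB_ge z w; lra.
Qed.

Lemma onsquare_neq s z w : 0 < s -> cmod w <= s / 2 -> onsquare s z ->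
  z - w != 0.
Proof.
move=> s0 ws /(onsquare_dist s0 ws) h; rewrite -cmod_gt0.
by apply: lt_le_trans h; rewrite divr_gt0.
Qed.

Lemma onsquare_rectcont s f : 0 < s ->
  (forall z, onsquare s z -> ccont f z) -> rectcont f (- s) s (- s) s.
Proof.
move=> s0 cf; have ss : - s <= s by lra.
do 2 split=> //.
split=> t ts; apply: cf; split; rewrite /inrect ?creE ?cimE ?eqxx ?orbT //;
  by split; lra.
Qed.

Definition sqint s f := rectint f (- s) s (- s) s.

Lemma sqint_le s f (M : R) : 0 < s -> (forall z, onsquare s z -> ccont f z) ->
  (forall z, onsquare s z -> cmod (f z) <= M) -> cmod (sqint s f) <= 16 * (M * s).
Proof.
move=> s0 cf fM; apply: (le_trans (@rectint_le _ f _ _ _ _ M _ _)).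
- exact: onsquare_rectcont.
- by move=> z z1 z2; exact: fM.
- by rewrite opprK; lra.
Qed.

Lemma eq_sqint s f g : 0 < s -> (forall z, onsquare s z -> f z = g z) ->
  sqint s f = sqint s g.
Proof.
move=> s0 fg; apply: eq_rectint; [|lra|lra].
by move=> z z1 z2; exact: fg.
Qed.

(* The Cauchy transform is not normalised: the role of [2 i pi] is played by
   [ctrans s (fun=> 1) w], which is only shown to be nonzero near [w = 0]. *)
Definition ctrans s f w := sqint s (fun z => f z * (z - w)^-1).

Lemma ccont_kernel w z : z - w != 0 -> ccont (fun z : C => (z - w)^-1) z.
Proof.
move=> zw; apply: (@ccontV _ (fun z => z - w)) => //.
by apply: ccontB; [exact: ccont_id|exact: ccont_cst].
Qed.

Section Transform.
Variables (s : R) (f : C -> C) (M : R).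
Hypotheses (s0 : 0 < s) (cf : forall z, onsquare s z -> ccont f z)
  (fM : forall z, onsquare s z -> cmod (f z) <= M).

Lemma ctrans_cont w z : cmod w <= s / 2 -> onsquare s z ->
  ccont (fun z => f z * (z - w)^-1) z.
Proof.
move=> ws hz; apply: ccontM; first exact: cf.
by apply: ccont_kernel; exact: onsquare_neq ws hz.
Qed.

(** The boundary of the square is at distance at least [s] from 0, hence at least [s / 2] from
    [w]. *)
Lemma kernel_le w z : cmod w <= s / 2 -> onsquare s z ->
  cmod (z - w)^-1 <= 2 / s.
Proof.
move=> ws hz; rewrite cmodV -[2 / s]invf_div lef_pV2 ?posrE ?divr_gt0 //.
  exact: onsquare_dist.
by rewrite cmod_gt0; exact: onsquare_neq ws hz.
Qed.

(** The side length cancels against the kernel bound [2 / s], so the constant does not depend on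
    [s]. *)
Lemma ctrans_le w : cmod w <= s / 2 -> cmod (ctrans s f w) <= 32 * M.
Proof.
move=> ws; have -> : 32 * M = 16 * ((M * (2 / s)) * s) by field; rewrite gt_eqF.
apply: sqint_le => // z hz; first exact: ctrans_cont.
by rewrite cmodM ler_pM ?cmod_ge0 ?fM ?kernel_le.
Qed.

(** The resolvent identity for the kernels, integrated. It gives both the Lipschitz bound and, with
    [w' = 0], the expansion in powers of [w]. *)
Lemma ctransB w w' : cmod w <= s / 2 -> cmod w' <= s / 2 ->
  ctrans s f w - ctrans s f w' =
  (w - w') * sqint s (fun z => f z * (z - w)^-1 * (z - w')^-1).
Proof.
move=> ws ws'; rewrite /ctrans /sqint -rectintB; last first.
- by apply: onsquare_rectcont => // z; exact: ctrans_cont.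
- by apply: onsquare_rectcont => // z; exact: ctrans_cont.
rewrite -rectintZ; last first.
  apply: onsquare_rectcont => // z hz; apply: ccontM; first exact: ctrans_cont.
  by apply: ccont_kernel; exact: onsquare_neq ws' hz.
rewrite -!/(sqint s _); apply: eq_sqint => // z hz; have := onsquare_neq s0 ws hz.
by have := onsquare_neq s0 ws' hz => z1 z2; field; apply/andP.
Qed.

Lemma ctrans_lip w w' : cmod w <= s / 2 -> cmod w' <= s / 2 ->
  cmod (ctrans s f w - ctrans s f w') <= 64 * M / s * cmod (w - w').
Proof.
move=> ws ws'; rewrite ctransB // cmodM mulrC ler_wpM2r ?cmod_ge0 //.
have -> : 64 * M / s = 16 * ((M * (2 / s) * (2 / s)) * s).
  by field; rewrite gt_eqF.
apply: sqint_le => // z hz.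
  apply: ccontM; first exact: ctrans_cont.
  by apply: ccont_kernel; exact: onsquare_neq ws' hz.
rewrite !cmodM !ler_pM ?mulr_ge0 ?cmod_ge0 ?fM ?kernel_le //.
Qed.

Lemma ctrans_step w : cmod w <= s / 2 ->
  ctrans s f w = ctrans s f 0 + w * ctrans s (fun z => f z * z^-1) w.
Proof.
move=> ws; have s2 : cmod (0 : C) <= s / 2 by rewrite cmod0 divr_ge0 // ltW.
have := ctransB ws s2; rewrite subr0 => h.
have -> : ctrans s f w = ctrans s f 0 + (ctrans s f w - ctrans s f 0) by ring.
rewrite h; congr (_ + _ * _).
by apply: eq_sqint => // z _; rewrite subr0; ring.
Qed.

End Transform.

(** Taylor's formula with remainder when the first [n] coefficients vanish: up to normalisation, the
    [k]-th coefficient is the transform of [f z * z^-1 ^+ k] at 0, and each use of [ctrans_step]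
    splits off one of them. *)
Lemma ctrans_iter s f n w : 0 < s -> cmod w <= s / 2 ->
  (forall z, onsquare s z -> ccont f z) ->
  (forall k, (k < n)%N -> ctrans s (fun z => f z * z^-1 ^+ k) 0 = 0) ->
  ctrans s f w = w ^+ n * ctrans s (fun z => f z * z^-1 ^+ n) w.
Proof.
move=> s0 ws cf; elim: n => [|n ih] h.
  by rewrite mul1r; apply: eq_sqint => // z _; rewrite expr0 mulr1.
rewrite ih => [|k kn]; last by apply: h; rewrite ltnS ltnW.
rewrite (@ctrans_step s (fun z => f z * z^-1 ^+ n)) //; last first.
  move=> z hz; apply: ccontM; first exact: cf.
  have z0 : z != 0 by rewrite -cmod_gt0; apply: lt_le_trans (onsquare_ge s0 hz).
  elim: n {ih h} => [|n ih]; first by under eq_fun do rewrite expr0; exact: ccont_cst.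
  under eq_fun do rewrite exprS.
  by apply: ccontM => //; apply: (@ccontV _ id) => //; exact: ccont_id.
rewrite h // add0r exprSr -mulrA; congr (_ * (_ * _)).
by apply: eq_sqint => // z _; rewrite exprSr mulrA.
Qed.

(** The true value is [2 i pi], but a crude bound suffices: on each side, of length [2 * s], the
    component of [1 / z] that enters the imaginary part is at least [1 / (2 * s)], so each side
    contributes at least 1. *)
Lemma ctrans1_neq0 s : 0 < s -> ctrans s (fun=> 1) 0 != 0.
Proof.
move=> s0; apply/eqP => h.
suff : 4 <= cim (ctrans s (fun=> 1) 0) by rewrite h cim0; lra.
have ss : - s <= s by lra.
have E z : 1 * (z - 0)^-1 = z^-1 :> C by rewrite mul1r subr0.
rewrite /ctrans /sqint.
have c1 z : onsquare s z -> ccont (fun z => 1 * (z - 0)^-1) z.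
  by apply: ctrans_cont => //; [move=> *; exact: ccont_cst|rewrite cmod0 divr_ge0 // ltW].
have [_ [_ [F1 F2 F3 F4]]] := onsquare_rectcont s0 c1.
rewrite /rectint cimD cimB cimM creE cimE mul1r mul0r add0r creB.
have V (x y : R) : (cpx x y)^-1 = cpx (x / (x ^+ 2 + y ^+ 2)) (- (y / (x ^+ 2 + y ^+ 2))).
  by [].
have D (x t : R) : x ^+ 2 = s ^+ 2 -> - s <= t <= s ->
    (2 * s)^-1 <= s / (x ^+ 2 + t ^+ 2) /\ (2 * s)^-1 <= s / (t ^+ 2 + x ^+ 2).
  move=> -> ts; rewrite [t ^+ 2 + _]addrC.
  have st : t ^+ 2 <= s ^+ 2.
    have : 0 <= (s - t) * (s + t) by apply: mulr_ge0; lra.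
    by rewrite -subr_sqr subr_ge0.
  have t0 : 0 <= t ^+ 2 by rewrite sqr_ge0.
  have p1 : 0 < s ^+ 2 + t ^+ 2 by nra.
  rewrite ler_pdivlMr // mulrC ler_pdivrMr; nra.
have cst (k : R) : rcont (- s) s (fun=> k) by move=> t _; exact: cst_continuous.
have B (u : R -> R) : rcont (- s) s u ->
    (forall t, - s <= t <= s -> (2 * s)^-1 <= u t) -> 1 <= rint (- s) s u.
  move=> cu hu.
  have <- : rint (- s) s (fun=> (2 * s)^-1) = 1.
    by rewrite rint_cst // opprK; field; rewrite gt_eqF.
  exact: rint_le.
have N (u : R -> R) : rcont (- s) s u ->
    (forall t, - s <= t <= s -> u t <= - (2 * s)^-1) -> rint (- s) s u <= -1.
  move=> cu hu.
  have <- : rint (- s) s (fun=> - (2 * s)^-1) = -1.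
    by rewrite rint_cst // opprK; field; rewrite gt_eqF.
  exact: rint_le.
have G1 := pconton_h F1; have G2 := pconton_h F2.
have G3 := pconton_v F3; have G4 := pconton_v F4.
have b1 : 1 <= cim (cint (- s) s (fun t => 1 * (cpx t (- s) - 0)^-1)).
  apply: B => [t /G1|t ts]; first exact: pcont_im.
  by rewrite E V cimE mulNr opprK; have [] := D (- s) t (sqrrN s) ts.
have b2 : cim (cint (- s) s (fun t => 1 * (cpx t s - 0)^-1)) <= -1.
  apply: N => [t /G2|t ts]; first exact: pcont_im.
  by rewrite E V cimE lerN2; have [] := D s t erefl ts.
have b3 : cre (cint (- s) s (fun t => 1 * (cpx (- s) t - 0)^-1)) <= -1.
  apply: N => [t /G3|t ts]; first exact: pcont_re.
  by rewrite E V creE mulNr lerN2; have [] := D (- s) t (sqrrN s) ts.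
have b4 : 1 <= cre (cint (- s) s (fun t => 1 * (cpx s t - 0)^-1)).
  apply: B => [t /G4|t ts]; first exact: pcont_re.
  by rewrite E V creE; have [] := D s t erefl ts.
by move: b1 b2 b3 b4; move: (cim _) (cim _) (cre _) (cre _) => ? ? ? ?; clear; lra.
Qed.

End CauchyTransform.

(** * Cauchy's formula on a square and factorisation at a zero *)

Section LocalForm.
Variable R : realType.
Notation C := (Cplx R).
Implicit Types (f g : C -> C) (s r : R).

Lemma inrect_cmod s z : inrect (- s) s (- s) s z -> cmod z <= 2 * s.
Proof. by move=> [h1 h2]; apply: cmod_max; rewrite ler_norml. Qed.

(** The difference quotient of [f] at [w], completed by the derivative [k], is continuous and
    differentiable off [w], so its integral vanishes by [rectint_removable]; splitting it gives the
    formula. The radius [2 * s] covers the corners of the square. *)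
Lemma cauchy_square f s w : 0 < s -> cmod w <= s / 2 ->
  (forall z, cmod z <= 2 * s -> exists k, cder f z k) ->
  ctrans s f w = f w * ctrans s (fun=> 1) w.
Proof.
move=> s0 ws df.
have [k hk] : exists k, cder f w k by apply: df; have := s0; lra.
pose h (z : C) := if z == w then k else (f z - f w) * (z - w)^-1.
have cf z : onsquare s z -> ccont f z.
  by move=> [/inrect_cmod/df[k' hk'] _]; exact: cder_cont hk'.
have dh z : inrect (- s) s (- s) s z -> z != w -> exists k, cder h z k.
  move=> /inrect_cmod/df[k' hk'] zw.
  have [k2 hk2] := cder_div zw (cderB_cst (f w) hk').
  exists k2; apply: (cder_near (d := cmod (z - w))) hk2.
    by rewrite cmod_gt0 subr_eq0.
  move=> u uz; rewrite /h ifN //; apply: contraTneq uz => ->.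
  by rewrite cmodB ltxx.
have : sqint s h = 0.
  have := cre_le w; have := cim_le w; rewrite !ler_norml => /andP[? ?] /andP[? ?].
  apply: (rectint_removable (w := w)); [lra|lra| |exact: dh].
  move=> z hz; have [->|zw] := eqVneq z w; last first.
    by have [k2 hk2] := dh z hz zw; exact: cder_cont hk2.
  move=> e e0; have e2 : 0 < e / 2 by rewrite divr_gt0.
  have [d d0 hd] := hk _ e2; exists d => // u uw.
  rewrite /h eqxx; case: eqVneq => [_|uw']; first by rewrite subrr cmod0.
  have uw0 : u - w != 0 by rewrite subr_eq0.
  have -> : (f u - f w) * (u - w)^-1 - k = (f u - f w - k * (u - w)) * (u - w)^-1.
    by field.
  rewrite cmodM cmodV ltr_pdivrMr ?cmod_gt0 //.
  by apply: (le_lt_trans (hd u uw)); rewrite ltr_pM2r ?cmod_gt0 //; lra.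
rewrite (@eq_sqint _ s h (fun z => f z * (z - w)^-1 - f w * (1 * (z - w)^-1))) //;
    last first.
  move=> z hz; have := onsquare_neq s0 ws hz; rewrite subr_eq0 => zw.
  by rewrite /h ifN // mul1r mulrBl.
have c1 z : onsquare s z -> ccont (fun z => 1 * (z - w)^-1) z.
  by apply: ctrans_cont => // *; exact: ccont_cst.
have c2 := onsquare_rectcont s0 c1.
rewrite /sqint rectintB.
- by rewrite rectintZ // => /eqP; rewrite subr_eq0 => /eqP.
- by apply: onsquare_rectcont => // z hz; exact: (ctrans_cont s0 cf ws hz).
- by apply: onsquare_rectcont => // z hz; apply: ccontM; [exact: ccont_cst|exact: c1].
Qed.

(** Near 0, [F * I] is the transform of [F]. If all its Taylor coefficients [J k 0] vanish, so does
    [F]; otherwise the first nonzero one gives the order [m], and [G] is the quotient of the two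
    Lipschitz functions [J m] and [I]. *)
Lemma local_form f z0 r : 0 < r ->
  (forall z, cmod (z - z0) < r -> exists k, cder f z k) ->
  (exists2 r' : R, 0 < r' & forall z, cmod (z - z0) < r' -> f z = f z0) \/
  exists m (G : C -> C) (r' K : R), [/\ 0 < r', 0 <= K, G 0 != 0,
    forall w w', cmod w < r' -> cmod w' < r' ->
      cmod (G w - G w') <= K * cmod (w - w') &
    forall w, cmod w < r' -> f (z0 + w) = f z0 + w ^+ m.+1 * G w].
Proof.
move=> r0 df.
pose F (z : C) := f (z0 + z) - f z0.
have dF z : cmod z < r -> exists k, cder F z k.
  move=> zr; have [|k hk] := df (z0 + z); first by rewrite addrC addKr.
  by exists k; apply: cderB_cst; exact: cder_shift.
have F0 : F 0 = 0 by rewrite /F addr0 subrr.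
have [d d0 hd] : exists2 d : R, 0 < d & forall z, cmod z < d -> cmod (F z) < 1.
  have [|k /cder_cont/(_ 1 ltr01)[d d0 hd]] := dF 0; first by rewrite cmod0.
  by exists d => // z zd; have := hd z; rewrite F0 !subr0; exact.
(* The disc of radius [2 * s] contains the square and lies where [F] is differentiable and bounded
   by 1. *)
pose s := Num.min r d / 4.
have rd0 : 0 < Num.min r d by rewrite lt_min r0.
have s0 : 0 < s by rewrite /s divr_gt0.
have [sr sd] : 2 * s < r /\ 2 * s < d.
  have : Num.min r d <= r by rewrite ge_min lexx.
  have : Num.min r d <= d by rewrite ge_min lexx orbT.
  by rewrite /s; lra.
have dFs z : cmod z <= 2 * s -> exists k, cder F z k.
  by move=> zs; apply: dF; exact: le_lt_trans sr.
have cF z : onsquare s z -> ccont F z.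
  by move=> [/inrect_cmod/dFs[k' hk'] _]; exact: cder_cont hk'.
have FM z : onsquare s z -> cmod (F z) <= 1.
  by move=> [/inrect_cmod zs _]; apply/ltW/hd; exact: le_lt_trans sd.
pose I := ctrans s (fun=> 1).
pose phi k (z : C) := F z * z^-1 ^+ k.
pose J k := ctrans s (phi k).
have c1 z : onsquare s z -> ccont (fun=> 1 : C) z by move=> _; exact: ccont_cst.
have onez z : onsquare s z -> cmod (1 : C) <= 1 by rewrite cmod1.
have z_neq0 z : onsquare s z -> z != 0.
  by move=> hz; rewrite -cmod_gt0; exact: lt_le_trans (onsquare_ge s0 hz).
have cphi k z : onsquare s z -> ccont (phi k) z.
  move=> hz; apply: ccontM; first exact: cF.
  elim: k => [|k ih]; first by under eq_fun do rewrite expr0; exact: ccont_cst.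
  under eq_fun do rewrite exprS.
  apply: ccontM => //; apply: (@ccontV _ id); [exact: z_neq0|exact: ccont_id].
have phiM k z : onsquare s z -> cmod (phi k z) <= s^-1 ^+ k.
  move=> hz; rewrite /phi cmodM cmodX cmodV -[leRHS]mul1r.
  apply: ler_pM; rewrite ?cmod_ge0 ?exprn_ge0 ?invr_ge0 ?cmod_ge0 ?FM //.
  apply: lerXn2r; rewrite ?nnegrE ?invr_ge0 ?cmod_ge0 ?(ltW s0) //.
  rewrite lef_pV2 ?posrE ?(onsquare_ge s0 hz) //.
  exact: lt_le_trans (onsquare_ge s0 hz).
have FE w : cmod w <= s / 2 -> F w * I w = ctrans s F w.
  by move=> ws; rewrite /I -cauchy_square.
have I0 : 0 < cmod (I 0) by rewrite cmod_gt0; exact: ctrans1_neq0.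
have s2 : cmod (0 : C) <= s / 2 by rewrite cmod0 divr_ge0 // ltW.
(* As [I] has Lipschitz constant [64 / s], it varies by at most half of [cmod (I 0)] within this
   radius. *)
pose t := Num.min (s / 2) (cmod (I 0) * s / 128).
have t0 : 0 < t by rewrite lt_min !divr_gt0 // mulr_gt0.
have ts : t <= s / 2 by rewrite ge_min lexx.
have It w : cmod w < t -> cmod (I 0) / 2 <= cmod (I w).
  move=> wt; have ws : cmod w <= s / 2 by exact: le_trans (ltW wt) ts.
  have := ctrans_lip s0 c1 onez s2 ws; rewrite sub0r cmodN -/I mulr1 => h.
  have : 64 / s * cmod w <= cmod (I 0) / 2.
    have : t <= cmod (I 0) * s / 128 by rewrite ge_min lexx orbT.
    move=> tI; have : cmod w <= cmod (I 0) * s / 128 by exact: le_trans (ltW wt) tI.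
    move=> h1; rewrite -[cmod (I 0) / 2](_ : 64 / s * (cmod (I 0) * s / 128) = _).
      by rewrite ler_pM2l // divr_gt0.
    by field; rewrite gt_eqF.
  by have := cmodB_ge (I 0) (I w); lra.
have In0 w : cmod w < t -> I w != 0.
  by move=> /It h; rewrite -cmod_gt0; apply: lt_le_trans h; rewrite divr_gt0.
have [[k0 Pk0]|noP] := pselect (exists k, J k 0 != 0); last first.
  left; exists t => // z zt; set w := z - z0.
  have ws : cmod w <= s / 2 by exact: le_trans (ltW zt) ts.
  suff /eqP : cmod (ctrans s F w) = 0.
    rewrite cmod_eq0 -FE // mulf_eq0 (negbTE (In0 w zt)) orbF /F /w subr_eq0.
    by rewrite addrC subrK => /eqP.
  (* Splitting off [n] vanishing coefficients bounds the transform by [(s / 2) ^+ n] times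
     [32 * s^-1 ^+ n]. *)
  have small n : cmod (ctrans s F w) <= 32 / 2 ^+ n.
    rewrite (@ctrans_iter _ s F n) //; last first.
      by move=> k _; apply/eqP; apply: contrapT => /negP h; apply: noP; exists k.
    rewrite cmodM cmodX.
    have h1 := ctrans_le s0 (cphi n) (phiM n) ws.
    apply: (@le_trans _ _ ((s / 2) ^+ n * (32 * s^-1 ^+ n))).
      apply: ler_pM => //; rewrite ?exprn_ge0 ?cmod_ge0 //.
      by apply: lerXn2r; rewrite ?nnegrE ?cmod_ge0 // divr_ge0 // ltW.
    rewrite le_eqVlt exprMn !exprVn; apply/orP; left; apply/eqP; field.
    by rewrite !expf_neq0 ?pnatr_eq0 ?gt_eqF.
  apply/eqP; rewrite eq_le cmod_ge0 andbT leNgt; apply/negP => K0.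
  by have [n hn] := half_pow_lt 32 K0; have := small n; lra.
have [m Pm minm] := ex_minnP (ex_intro (fun k => J k 0 != 0) k0 Pk0).
have JE w : cmod w <= s / 2 -> ctrans s F w = w ^+ m * J m w.
  move=> ws; apply: ctrans_iter => // k km; apply/eqP; apply: contraTT km => Pk.
  by rewrite -leqNgt; exact: minm.
(* The coefficient of order 0 is [F 0 * I 0 = 0]; hence [m.-1] is a legitimate witness for an
   exponent counted from 1. *)
have m0 : (0 < m)%N.
  rewrite lt0n; apply/eqP => m0; move: Pm; rewrite m0.
  have := JE 0 s2; rewrite m0 expr0 mul1r => <-; rewrite -FE // F0 mul0r.
  by rewrite eqxx.
right; exists m.-1, (fun w => J m w * (I w)^-1), t.
pose A := s^-1 ^+ m.
have A0 : 0 <= A by rewrite exprn_ge0 // invr_ge0 ltW.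
pose i0 := cmod (I 0).
(* The Lipschitz constant of a quotient, read off the identity [divB] below, with [2 / i0] bounding
   the inverse of [I]. *)
exists (64 * A / s * (2 / i0) + 32 * A * (64 * 1 / s * (2 / i0) * (2 / i0))).
have sge : 0 <= s^-1 by rewrite invr_ge0 ltW.
have ige : 0 <= i0^-1 by rewrite invr_ge0 ltW.
split => //.
- by rewrite addr_ge0 // !mulr_ge0.
- by rewrite mulf_neq0 // invr_eq0 In0 // cmod0.
- move=> w w' wt wt'.
  have ws : cmod w <= s / 2 by exact: le_trans (ltW wt) ts.
  have ws' : cmod w' <= s / 2 by exact: le_trans (ltW wt') ts.
  have Iw := In0 w wt; have Iw' := In0 w' wt'.
  have Ile u : cmod u < t -> cmod (I u)^-1 <= 2 / i0.
    move=> ut; rewrite cmodV -[2 / i0]invf_div lef_pV2 ?posrE ?divr_gt0 ?It //.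
    by rewrite cmod_gt0 In0.
  have divB (x x' y y' : C) : y != 0 -> y' != 0 -> x * y^-1 - x' * y'^-1 =
      (x - x') * y^-1 + x' * ((y' - y) * y^-1 * y'^-1).
    by move=> y0 y'0; field; rewrite y0 y'0.
  rewrite (divB _ _ _ _ Iw Iw').
  have j1 := ctrans_lip s0 (cphi m) (phiM m) ws ws'; rewrite -/(J m) -/A in j1.
  have j2 := ctrans_le s0 (cphi m) (phiM m) ws'; rewrite -/(J m) -/A in j2.
  have j3 := ctrans_lip s0 c1 onez ws' ws; rewrite -/I [cmod (w' - w)]cmodB in j3.
  have j4 := Ile w wt; have j5 := Ile w' wt'.
  apply: (le_trans (cmodD _ _)); rewrite !cmodM mulrDl.
  have [[[[i1 i2] i3] i4] i5] := (cmod_ge0 (J m w - J m w'), cmod_ge0 (J m w'),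
    cmod_ge0 (I w' - I w), cmod_ge0 (I w)^-1, cmod_ge0 (I w')^-1).
  move: j1 j2 j3 j4 j5 i1 i2 i3 i4 i5.
  move: (cmod (J m w - J m w')) (cmod (J m w')) (cmod (I w' - I w)) (cmod (I w)^-1)
    (cmod (I w')^-1) (cmod (w - w')) (2 / i0) (64 * A / s) (32 * A) (64 * 1 / s).
  clear=> y1 y2 y3 y4 y5 x b1 b2 b3 b4 j1 j2 j3 j4 j5 i1 i2 i3 i4 i5.
  apply: lerD; first by rewrite [leRHS]mulrAC; exact: ler_pM.
  rewrite -[leRHS]mulrA; apply: ler_pM => //; first by do 2 apply: mulr_ge0 => //.
  rewrite [leRHS]mulrAC; apply: ler_pM => //; first by apply: mulr_ge0.
  by rewrite [leRHS]mulrAC; exact: ler_pM.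
- move=> w wt; have ws : cmod w <= s / 2 by exact: le_trans (ltW wt) ts.
  rewrite prednK // mulrA -JE // -FE // mulfK ?In0 // /F; ring.
Qed.

End LocalForm.

(** * Isolated fibers, isolated critical points, strict differentiability *)

Section LocalConsequences.
Variable R : realType.
Notation C := (Cplx R).
Implicit Types (f g : C -> C) (r : R).

Lemma cder_uniq f z k k' : cder f z k -> cder f z k' -> k = k'.
Proof. by move=> /cder_derive1 <- /cder_derive1 <-. Qed.

Lemma cder_factor f (H : C -> C) z0 r : 0 < r -> ccont H 0 ->
  (forall w, cmod w < r -> f (z0 + w) = f z0 + w * H w) -> cder f z0 (H 0).
Proof.
move=> r0 cH fE e e0; have [d d0 hd] := cH e e0.
exists (Num.min r d); first by rewrite lt_min r0.
move=> w; rewrite lt_min => /andP[wr wd].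
have := fE _ wr; rewrite subrKC => ->.
have -> : f z0 + (w - z0) * H (w - z0) - f z0 - H 0 * (w - z0) =
  (H (w - z0) - H 0) * (w - z0) by ring.
by rewrite cmodM ler_wpM2r ?cmod_ge0 // ltW // hd // subr0.
Qed.

Lemma cder_exp m z : cder (fun u : C => u ^+ m) z (m%:R * z ^+ m.-1).
Proof.
elim: m => [|m ih] e e0.
  by exists 1 => // w _; rewrite !expr0 subrr mul0r mul0r subr0 cmod0
    mulr_ge0 ?cmod_ge0 // ltW.
set k := m%:R * z ^+ m.-1 in ih.
have kz : m.+1%:R * z ^+ m.+1.-1 = k * z + z ^+ m.
  rewrite /k; case: (m) => [|n] /=; first by rewrite !mul0r expr0 mulr1 add0r.
  by rewrite -[n.+2]addn1 natrD mulrDl mul1r -mulrA -exprSr.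
rewrite kz; clearbody k; clear kz.
(* [A] dominates both [cmod w], for [w] within distance 1 of [z], and [cmod k]. *)
pose A := cmod z + 1 + cmod k.
have [kz0 zz0] := (cmod_ge0 k, cmod_ge0 z).
have A0 : 0 < A by rewrite /A; lra.
have e2 : 0 < e / (2 * A) by rewrite divr_gt0 // mulr_gt0.
have [d d0 hd] := ih _ e2.
exists (Num.min (Num.min 1 d) (e / (2 * A))); first by rewrite !lt_min ltr01 d0.
move=> w; rewrite !lt_min => /andP[/andP[w1 /hd hw] we].
have -> : w ^+ m.+1 - z ^+ m.+1 - (k * z + z ^+ m) * (w - z) =
  (w ^+ m - z ^+ m - k * (w - z)) * w + k * (w - z) * (w - z).
  by rewrite !exprS; ring.
apply: (le_trans (cmodD _ _)); rewrite !cmodM.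
have wle : cmod w <= cmod z + 1 by have := cmodB_ge w z; lra.
have D0 := cmod_ge0 (w - z).
apply: (@le_trans _ _ (e / (2 * A) * cmod (w - z) * A + A * (e / (2 * A)) * cmod (w - z))).
  apply: lerD.
    by apply: ler_pM; rewrite ?cmod_ge0 //; rewrite /A; lra.
  apply: ler_wpM2r => //; apply: ler_pM; rewrite ?cmod_ge0 //; last exact: ltW.
  by rewrite /A; lra.
by rewrite le_eqVlt; apply/orP; left; apply/eqP; field; rewrite gt_eqF.
Qed.

(* [f - f z0] vanishes to order [m + 1] at [z0]. *)
Definition lipform f z0 m (G : C -> C) r K := [/\ 0 < r, 0 <= K, G 0 != 0,
    forall w w', cmod w < r -> cmod w' < r ->
      cmod (G w - G w') <= K * cmod (w - w') &
    forall w, cmod w < r -> f (z0 + w) = f z0 + w ^+ m.+1 * G w].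

Lemma lipform_cont f z0 m G r K w : lipform f z0 m G r K -> cmod w < r -> ccont G w.
Proof.
move=> [r0 K0 _ GK _] wr e e0.
exists (Num.min (r - cmod w) (e / (K + 1))).
  by rewrite lt_min subr_gt0 wr divr_gt0 //; lra.
move=> u; rewrite lt_min => /andP[u1 u2].
have ur : cmod u < r by have := cmodB_ge u w; lra.
apply: (le_lt_trans (GK _ _ ur wr)).
move: u2; rewrite ltr_pdivlMr; last by lra.
by have := cmod_ge0 (u - w); nra.
Qed.

Lemma lipform_neq0 f z0 m G r K : lipform f z0 m G r K ->
  exists2 r' : R, 0 < r' <= r & forall w, cmod w < r' -> cmod (G 0) / 2 <= cmod (G w).
Proof.
move=> [r0 K0 G0 GK _]; have g0 : 0 < cmod (G 0) by rewrite cmod_gt0.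
exists (Num.min r (cmod (G 0) / (2 * (K + 1)))).
  by rewrite lt_min r0 ge_min lexx divr_gt0 // mulr_gt0 //; lra.
move=> w; rewrite lt_min => /andP[wr].
rewrite ltr_pdivlMr ?mulr_gt0 //; last by lra.
have := GK 0 w; rewrite cmod0 sub0r cmodN => /(_ r0 wr).
by have := cmodB_ge (G 0) (G w); have := cmod_ge0 w; nra.
Qed.

Lemma lipform_isolated f z0 m G r K : lipform f z0 m G r K ->
  exists2 r' : R, 0 < r' & forall z, cmod (z - z0) < r' -> z != z0 -> f z != f z0.
Proof.
move=> L; have [r' /andP[r0 rr] hr] := lipform_neq0 L.
case: L => [_ _ G0 _ fE]; exists r' => // z zr zz.
have := fE (z - z0); rewrite subrKC => -> //; last exact: lt_le_trans rr.
rewrite -subr_eq0 addrKC mulf_neq0 ?expf_neq0 ?subr_eq0 //.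
rewrite -cmod_gt0; apply: lt_le_trans (hr _ zr).
by rewrite divr_gt0 // cmod_gt0.
Qed.

(** As [G] is not known to be differentiable, the product rule is replaced by increments along a
    small real [h]. The variation of [w ^+ m.+1] contributes at least about [P * h * (g0 / 2)], that
    of [G] at most half as much once [K * cmod w <= g0 / 4], and a zero derivative would force the
    total below [e * h]. *)
Lemma lipform_noncrit f z0 m G r K : lipform f z0 m G r K ->
  exists2 r' : R, 0 < r' &
    forall z, cmod (z - z0) < r' -> z != z0 -> ~ cder f z 0.
Proof.
move=> L; have [r' /andP[r0 rr] hr] := lipform_neq0 L.
have [r1 K0 G0 GK fE] := L; set g0 := cmod (G 0) in hr.
have g00 : 0 < g0 by rewrite cmod_gt0.
exists (Num.min r' (g0 / (4 * (K + 1)))).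
  by rewrite lt_min r0 divr_gt0 // mulr_gt0 //; lra.
move=> z; rewrite lt_min => /andP[zr zK] zz df.
set w := z - z0 in zr zK; have zE : z = z0 + w by rewrite /w subrKC.
have w0 : 0 < cmod w by rewrite cmod_gt0 subr_eq0.
have Kw : K * cmod w <= g0 / 4.
  move: zK; rewrite ltr_pdivlMr ?mulr_gt0 //; last by lra.
  by have := cmod_ge0 w; nra.
pose P := cmod w ^+ m; have P0 : 0 < P by rewrite exprn_gt0.
(* The error terms carrying [e] then sum to [P * g0 * h / 16], less than the surviving
   [P * g0 * h / 4]. *)
pose e := P * g0 / (8 * (g0 + 2)).
have e0 : 0 < e by rewrite divr_gt0 ?mulr_gt0 //; lra.
have [d1 d10 hd1] := df _ e0; have [d2 d20 hd2] := @cder_exp m.+1 w _ e0.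
pose h : R := Num.min (Num.min d1 d2) (r' - cmod w) / 2.
have h0 : 0 < h by rewrite divr_gt0 // !lt_min d10 d20 subr_gt0.
have [h1 [h2 h3]] : h < d1 /\ h < d2 /\ cmod w + h < r'.
  have : Num.min (Num.min d1 d2) (r' - cmod w) = 2 * h by rewrite /h; field.
  set M := Num.min _ _ => Mh.
  have : M <= Num.min d1 d2 by rewrite ge_min lexx.
  have : M <= r' - cmod w by rewrite ge_min lexx orbT.
  by rewrite le_min => ? /andP[? ?]; do ?split; lra.
have hh : cmod (h%:C%C : C) = h by rewrite cmod_real gtr0_norm.
set v := w + h%:C%C.
have vr : cmod v < r'.
  by rewrite /v; have := cmodD w h%:C%C; rewrite hh; lra.
have := hd1 (z + h%:C%C); rewrite addrKC hh => /(_ h1).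
rewrite mul0r subr0 zE -addrA -/w -/v.
have := hd2 v; rewrite /v addrKC hh => /(_ h2); rewrite -/v.
rewrite (fE v) ?(fE w); [|exact: lt_le_trans rr|exact: lt_le_trans rr].
set X := v ^+ m.+1 - w ^+ m.+1 => q1 q2.
have E2 : f z0 + v ^+ m.+1 * G v - (f z0 + w ^+ m.+1 * G w) =
    X * G v + w ^+ m.+1 * (G v - G w) by rewrite /X; ring.
have q3 : cmod (G v - G w) <= K * h.
  have := GK v w; rewrite /v addrKC hh -/v; apply.
    exact: lt_le_trans rr.
  exact: lt_le_trans rr.
have q4 : cmod (m.+1%:R * w ^+ m) * h - e * h <= cmod X.
  move: q1; rewrite cmodB /= => q1; set a := _ * h%:C%C in q1.
  have := cmodB_ge a (a - X); have -> : a - (a - X) = X by ring.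
  have -> : cmod a = cmod (m.+1%:R * w ^+ m) * h by rewrite /a cmodM hh.
  lra.
have q5 : P <= cmod (m.+1%:R * w ^+ m).
  rewrite cmodM cmodX -/P -[leLHS]mul1r ler_wpM2r ?(ltW P0) //.
  have -> : m.+1%:R = (m.+1%:R : R)%:C%C :> C by rewrite rmorph_nat.
  by rewrite cmod_real normr_nat ler1n.
have q6 : cmod X * (g0 / 2) <= cmod (X * G v).
  by rewrite cmodM ler_wpM2l ?cmod_ge0 // hr.
have q7 : cmod (w ^+ m.+1 * (G v - G w)) <= P * (g0 / 4) * h.
  rewrite cmodM cmodX exprSr -/P -!mulrA ler_wpM2l ?(ltW P0) //.
  apply: (@le_trans _ _ (cmod w * (K * h))); first by rewrite ler_wpM2l ?cmod_ge0.
  by rewrite mulrCA mulrA [leRHS]mulrA ler_wpM2r // ltW.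
have q8 := cmodD_ge (X * G v) (w ^+ m.+1 * (G v - G w)).
rewrite -E2 in q8.
have q9 : P * h * (g0 / 2) <= cmod (m.+1%:R * w ^+ m) * h * (g0 / 2).
  apply: ler_wpM2r; first by rewrite ltW // divr_gt0.
  by apply: ler_wpM2r => //; exact: ltW.
have q10 : (cmod (m.+1%:R * w ^+ m) * h - e * h) * (g0 / 2) <= cmod X * (g0 / 2).
  by rewrite ler_wpM2r // ltW // divr_gt0.
have q11 : P * h * (g0 / 2) - e * h * (g0 / 2) - P * (g0 / 4) * h <= e * h.
  by move: q2 q6 q7 q8 q9 q10; clear; lra.
have q12 : e * (8 * (g0 + 2)) = P * g0 by rewrite /e; field; lra.
have q13 : h * (P * g0 / 4 - e * (g0 + 2) / 2) <= 0 by move: q11; clear; lra.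
have : 0 < P * g0 by exact: mulr_gt0.
rewrite pmulr_rle0 // in q13; move: q12 q13; clear; lra.
Qed.

(** Used in contrapositive form: a nonzero derivative forces the exponent in the factorisation to be
    1. *)
Lemma lipform_crit0 f z0 m G r K k : lipform f z0 m.+1 G r K -> cder f z0 k -> k = 0.
Proof.
move=> L; have [r0 K0 G0 GK fE] := L.
have : cder f z0 (0 ^+ m.+1 * G 0).
  apply: (@cder_factor _ (fun w => w ^+ m.+1 * G w) _ r) => //.
    apply: ccontM; last by apply: (lipform_cont L); rewrite cmod0.
    exact: (cder_cont (@cder_exp m.+1 0)).
  by move=> w /fE ->; rewrite mulrA -exprS.
by move=> h /(cder_uniq h) <-; rewrite expr0n mul0r.
Qed.

(** Pointwise differentiability gives no uniform estimate, but the factorisation with exponent 1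
    does: the error is [(a - b) * (G a - G 0) + b * (G a - G b)], and each term is at most a quarter
    of [cmod k * cmod (a - b)]. *)
Lemma cder_strict f z0 r k : 0 < r ->
  (forall z, cmod (z - z0) < r -> exists k, cder f z k) ->
  cder f z0 k -> k != 0 ->
  exists2 r' : R, 0 < r' <= r & forall u v, cmod (u - z0) < r' -> cmod (v - z0) < r' ->
    cmod (f u - f v - k * (u - v)) <= cmod k / 2 * cmod (u - v).
Proof.
move=> r0 df dk k0; case: (local_form r0 df) => [[r' r'0 fc]|].
  case/eqP: k0; apply: (cder_uniq dk).
  move=> e e0; exists r' => // w /fc ->.
  by rewrite subrr mul0r subr0 cmod0 mulr_ge0 ?cmod_ge0 // ltW.
move=> [m [G [r1 [K L]]]].
case: m L => [|m] L; last by case/eqP: k0; exact: (lipform_crit0 L dk).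
have [r10 K0 G0 GK fE] := L.
have Gk : G 0 = k.
  apply: (cder_uniq _ dk); apply: (@cder_factor _ G _ r1) => //.
  by apply: (lipform_cont L); rewrite cmod0.
have kk : 0 < cmod k by rewrite cmod_gt0.
exists (Num.min (Num.min r r1) (cmod k / (4 * (K + 1)))).
  rewrite !lt_min r0 r10 divr_gt0 ?mulr_gt0 //=; last by lra.
  by rewrite !ge_min lexx.
move=> u v; rewrite !lt_min => /andP[/andP[ur ur1] uK] /andP[/andP[vr vr1] vK].
set a := u - z0 in ur ur1 uK *; set b := v - z0 in vr vr1 vK *.
have uvE : u - v = a - b by rewrite /a /b; ring.
rewrite uvE.
have -> : u = z0 + a by rewrite /a subrKC.
have -> : v = z0 + b by rewrite /b subrKC.
rewrite (fE _ ur1) (fE _ vr1) -Gk.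
have -> : f z0 + a ^+ 1 * G a - (f z0 + b ^+ 1 * G b) - G 0 * (a - b) =
   (a - b) * (G a - G 0) + b * (G a - G b) by rewrite !expr1; ring.
apply: (le_trans (cmodD _ _)); rewrite !cmodM Gk.
have h1 := GK _ _ ur1 vr1; have := GK a 0 ur1; rewrite cmod0 subr0 => /(_ r10) h2.
have Kc x : x < cmod k / (4 * (K + 1)) -> 0 <= x -> K * x <= cmod k / 4.
  rewrite ltr_pdivlMr ?mulr_gt0 //; last by lra.
  by move=> ? ?; nra.
have ka := Kc _ uK (cmod_ge0 _); have kb := Kc _ vK (cmod_ge0 _).
have D0 := cmod_ge0 (a - b).
apply: (@le_trans _ _ (cmod (a - b) * (cmod k / 4) + cmod b * (K * cmod (a - b)))).
  apply: lerD; apply: ler_wpM2l; rewrite ?cmod_ge0 //.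
  by rewrite Gk in h2; apply: (le_trans h2).
have := ler_wpM2r D0 kb; clear; lra.
Qed.

End LocalConsequences.

(** * Compactness and local inverses *)

Section Compactness.
Variable R : realType.
Notation C := (Cplx R).

Lemma closed_cmod (A : set C) :
  (forall z, (forall e : R, 0 < e -> exists2 w, A w & cmod (w - z) < e) -> A z) ->
  closed A.
Proof.
move=> h z clz; apply: h => e e0.
have /clz[w [Aw wz]] : nbhs z [set w | cmod (w - z) < e].
  by apply/nbhs_cmod; exists e.
by exists w.
Qed.

(** Heine-Borel, carried over from a square in [R * R] by the continuous map [cpx]. *)
Lemma compact_bounded_closed (A : set C) (M : R) : closed A ->
  (forall z, A z -> cmod z <= M) -> compact A.
Proof.
move=> cA AM.
pose b := (`[- M, M]%classic `*` `[- M, M]%classic : set (R * R)).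
have cb : compact b by apply: compact_setX; exact: segment_compact.
pose h (p : R * R) : C := cpx p.1 p.2.
have ch : continuous h.
  move=> p; apply: (@cvg_cmod R (R * R)%type (nbhs p) (nbhs_filter p) h (h p)).2.
  move=> e e0; apply/nbhs_ballP; exists (e / 2) => /=; first by rewrite divr_gt0.
  move=> q [/= q1 q2]; change (cmod (h q - h p) < e).
  apply: (le_lt_trans (cmod_le _)); rewrite creB cimB !creE !cimE.
  move: q1 q2; rewrite /ball /= => q1 q2.
  by rewrite distrC [ `|q.2 - _|]distrC; lra.
apply: (subclosed_compact cA (B := h @` b)).
  by apply: continuous_compact => //; exact: continuous_subspaceT.
move=> z Az; exists (cre z, cim z) => /=; last exact: cpxE.
have zM := AM _ Az; split; rewrite /= in_itv /= -ler_norml.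
  exact: le_trans (cre_le z) zM.
exact: le_trans (cim_le z) zM.
Qed.

(** Finitely many of the discs cover [A], and each meets [S] at most in its centre. *)
Lemma compact_isolated_finite (A S : set C) : compact A ->
  (forall z, A z -> exists2 r : R, 0 < r &
     forall w, cmod (w - z) < r -> w != z -> ~ S w) ->
  finite_set (A `&` S).
Proof.
rewrite compact_cover => cA h.
have /boolp.choice[r hr] (z : C) : exists r : R, A z -> 0 < r /\
     forall w, cmod (w - z) < r -> w != z -> ~ S w.
  have [Az|nA] := pselect (A z); last by exists 0.
  by have [r r0 hr] := h z Az; exists r.
pose U (z : C) := [set w : C | cmod (w - z) < r z].
have [|z Az|D DA AD] := cA C A U.
- move=> z Az; rewrite openE => w /= wz; apply/nbhs_cmod.
  exists (r z - cmod (w - z)); first by rewrite subr_gt0.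
  by move=> u uw; rewrite /U /=; have := cmod_tri u w z; lra.
- by exists z => //; rewrite /U /= subrr cmod0; case: (hr z Az).
suff AS : A `&` S `<=` [set` D] by exact: (sub_finite_set AS (finite_fset D)).
move=> z [Az Sz].
have [y /= yD zy] := AD z Az.
have Ay : A y by apply: set_mem; exact: DA.
have [_ hy] := hr y Ay.
by have [->//|zny] := eqVneq z y; case: (hy z zy zny Sz).
Qed.

Lemma ccont_dist (f : C -> C) (v z : C) : ccont f z ->
  {for z, continuous (fun z => cmod (f z - v))}.
Proof.
move=> cf; apply: (@cvgrPdist_lt _ _ _ (nbhs z) (nbhs_filter z) _ _).2 => e e0.
apply/nbhs_cmod.
have [d d0 hd] := cf e e0; exists d => // w /hd h.
apply: le_lt_trans h; rewrite ler_norml.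
have := cmod_tri (f z) (f w) v; have := cmod_tri (f w) (f z) v.
by rewrite [cmod (f z - f w)]cmodB; lra.
Qed.

(** The lower bound on increments is strict differentiability. For surjectivity, the distance from
    [f z] to [v] is minimised over a closed disc; the minimiser is interior, and a positive minimum
    could be lowered by a Newton step. *)
Lemma local_inverse (f : C -> C) z0 r k : 0 < r ->
  (forall z, cmod (z - z0) < r -> exists k, cder f z k) ->
  cder f z0 k -> k != 0 ->
  exists r' s c : R, [/\ 0 < r' <= r, 0 < s, 0 < c,
    forall u v, cmod (u - z0) < r' -> cmod (v - z0) < r' ->
      c * cmod (u - v) <= cmod (f u - f v) &
    (forall v, cmod (v - f z0) < s ->
      exists2 z, cmod (z - z0) < r' & f z = v)] /\
    (forall z, cmod (z - z0) < r' -> ~ cder f z 0).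
Proof.
move=> r0 df dk k0; have [r1 /andP[r10 r1r] hr1] := cder_strict r0 df dk k0.
have kk : 0 < cmod k by rewrite cmod_gt0.
set c := cmod k / 2 in hr1; have c0 : 0 < c by rewrite divr_gt0.
have lip u v : cmod (u - z0) < r1 -> cmod (v - z0) < r1 ->
    c * cmod (u - v) <= cmod (f u - f v).
  move=> ur vr; have := hr1 _ _ ur vr.
  have := cmodB_ge (k * (u - v)) (k * (u - v) - (f u - f v)).
  have -> : k * (u - v) - (k * (u - v) - (f u - f v)) = f u - f v by ring.
  by rewrite cmodM [cmod (_ - (f u - f v))]cmodB /c; nra.
have z0r : cmod (z0 - z0) < r1 by rewrite subrr cmod0.
(* If [v] is within this distance of [f z0], a minimiser [z] has [f z] within twice that distance of
   [f z0], so the lower bound [c] puts [z] within [r1 / 2] of [z0]. *)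
exists r1, (c * (r1 / 2) / 2), c; split; last first.
  move=> z zr dz.
  have [d d0 hd] := dz (c / 2) (divr_gt0 c0 (ltr0n _ 2)).
  pose h := Num.min d (r1 - cmod (z - z0)) / 2.
  have h0 : 0 < h by rewrite divr_gt0 // lt_min d0 subr_gt0.
  have [h1 h2] : h < d /\ cmod (z - z0) + h < r1.
    have : Num.min d (r1 - cmod (z - z0)) = 2 * h by rewrite /h; field.
    set M := Num.min _ _ => Mh.
    have : M <= d by rewrite ge_min lexx.
    have : M <= r1 - cmod (z - z0) by rewrite ge_min lexx orbT.
    by move=> ? ?; split; lra.
  have hh : cmod (h%:C%C : C) = h by rewrite cmod_real gtr0_norm.
  have zh : cmod (z + h%:C%C - z0) < r1.
    by have := cmodD (z - z0) h%:C%C; rewrite hh addrAC; lra.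
  have := lip _ _ zh zr; have := hd (z + h%:C%C); rewrite addrKC hh mul0r subr0.
  move=> /(_ h1); have : 0 < c * h by exact: mulr_gt0.
  by clear; lra.
split=> //; [by apply/andP|by rewrite !divr_gt0 ?mulr_gt0 ?divr_gt0|].
move=> v vs.
pose A := [set z : C | cmod (z - z0) <= r1 / 2].
have cA : compact A.
  apply: (@compact_bounded_closed _ (cmod z0 + r1 / 2)).
    apply: closed_cmod => z hz; rewrite /A /= leNgt; apply/negP => h.
    have [|w Aw wz] := hz (cmod (z - z0) - r1 / 2); first by rewrite subr_gt0.
    by move: Aw; rewrite /A /=; have := cmod_tri z w z0; rewrite [cmod (z - w)]cmodB; lra.
  by move=> z; rewrite /A /=; have := cmodB_ge z z0; lra.
have A0 : A !=set0 by exists z0; rewrite /A /= subrr cmod0 divr_ge0 // ltW.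
have cfA : {within A, continuous (fun z => cmod (f z - v))}.
  apply: continuous_in_subspaceT => z /set_mem; rewrite /A /= => zA.
  apply: ccont_dist; have [|k' hk'] := df z; last exact: cder_cont hk'.
  by lra.
have [z /set_mem zA zmin] := compact_EVT_min A0 cA cfA.
have zr : cmod (z - z0) <= r1 / 2 by exact: zA.
have fzv : cmod (f z - v) <= cmod (f z0 - v).
  by apply: zmin; apply/mem_set; rewrite /A /= subrr cmod0 divr_ge0 // ltW.
have zr1 : cmod (z - z0) < r1 by lra.
have zlt : cmod (z - z0) < r1 / 2.
  have := lip _ _ zr1 z0r; have := cmod_tri (f z) v (f z0).
  move: fzv; rewrite [cmod (f z0 - v)]cmodB => a1 a2 a3.
  have : c * cmod (z - z0) < c * (r1 / 2) by lra.
  by rewrite ltr_pM2l.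
exists z => //; apply/eqP; rewrite -subr_eq0 -cmod_eq0 eq_le cmod_ge0 andbT leNgt.
apply/negP => D0; set D := cmod (f z - v) in D0.
(* Moving [z] by [t * (v - f z) / k] multiplies [f z - v] by [1 - t], up to
   [t D / 2]. *)
pose q := cmod ((v - f z) / k).
have q0 : 0 < q by rewrite /q cmodM cmodV cmodB -/D mulr_gt0 // invr_gt0.
pose t := Num.min 1 ((r1 / 2 - cmod (z - z0)) / q) / 2.
have t0 : 0 < t by rewrite divr_gt0 // lt_min ltr01 divr_gt0 // subr_gt0.
have [t1 t2] : t <= 1 / 2 /\ t * q < r1 / 2 - cmod (z - z0).
  have : Num.min 1 ((r1 / 2 - cmod (z - z0)) / q) = 2 * t by rewrite /t; field.
  set M := Num.min _ _ => Mt.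
  have M1 : M <= 1 by rewrite ge_min lexx.
  have M2 : M <= (r1 / 2 - cmod (z - z0)) / q by rewrite ge_min lexx orbT.
  split; first by lra.
  by rewrite -ltr_pdivlMr //; lra.
pose h : C := t%:C%C * ((v - f z) / k).
have hq : cmod h = t * q by rewrite /h cmodM cmod_real gtr0_norm.
have zh : cmod (z + h - z0) < r1 / 2.
  by have := cmodD (z - z0) h; rewrite hq addrAC; lra.
have zhr : cmod (z + h - z0) < r1 by lra.
have := hr1 _ _ zhr zr1; rewrite addrKC.
have kh : k * h = t%:C%C * (v - f z) by rewrite /h mulrCA [k * _]mulrC divfK.
have ck : c * cmod h = t * D / 2.
  have : cmod (k * h) = t * D by rewrite kh cmodM cmod_real gtr0_norm // cmodB.
  by rewrite cmodM /c => h1; lra.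
rewrite ck => a1.
have a2 : D <= cmod (f (z + h) - v).
  by apply: zmin; apply/mem_set; exact: ltW.
have E : f (z + h) - v = (f (z + h) - f z - k * h) + (1 - t)%:C%C * (f z - v).
  by rewrite kh rmorphB rmorph1; ring.
have := cmodD (f (z + h) - f z - k * h) ((1 - t)%:C%C * (f z - v)).
rewrite -E cmodM cmod_real ger0_norm; last by lra.
rewrite -/D => a3; have : 0 < t * D by exact: mulr_gt0.
by move: a1 a2 a3; clear; lra.
Qed.

End Compactness.

(** * The circle of radius [eps] *)

Section Circle.
Variables (R : realType) (eps : R).
Hypothesis eps0 : 0 < eps.
Notation C := (Cplx R).
Notation T := ((pi : R) *+ 2).

Definition circle (t : R) : C := cpx (eps * cos t) (eps * sin t).

Lemma circle_cont t : pcont circle t.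
Proof.
move=> e e0; have e2 : 0 < e / (2 * eps) by rewrite divr_gt0 // mulr_gt0.
have /rcontinuousP/(_ _ e2)[d1 d10 h1] := @continuous_cos R t.
have /rcontinuousP/(_ _ e2)[d2 d20 h2] := @continuous_sin R t.
exists (Num.min d1 d2) => [|s]; first by rewrite lt_min d10.
rewrite lt_min => /andP[/h1 {}h1 /h2 {}h2].
apply: (le_lt_trans (cmod_le _)); rewrite creB cimB !creE !cimE -!mulrBr !normrM.
rewrite (gtr0_norm eps0) -mulrDr.
have -> : e = eps * (e / (2 * eps) + e / (2 * eps)) by field; rewrite gt_eqF.
by rewrite ltr_pM2l //; apply: ltrD.
Qed.

Lemma cmod_circle t : cmod (circle t) = eps.
Proof.
rewrite cmodE !creE !cimE !exprMn -mulrDr cos2Dsin2 mulr1 sqrtr_sqr.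
by rewrite gtr0_norm.
Qed.

Lemma circleD s t : circle (s + t) = circle s * cpx (cos t) (sin t).
Proof.
apply: cpx_ext; rewrite ?creM ?cimM !creE !cimE ?cosD ?sinD; ring.
Qed.

Lemma circle_periodic t n : circle (t + T *+ n) = circle t.
Proof.
elim: n => [|n ih]; first by rewrite mulr0n addr0.
by rewrite mulrSr addrA -ih /circle cosD2pi sinD2pi.
Qed.

Lemma T_gt0 : 0 < T. Proof. by rewrite pmulrn_lgt0 // pi_gt0. Qed.

(** The remainder [r] of [t - s] modulo [T] has cosine 1; injectivity of the cosine on [[0, pi]],
    applied to [r] or to [T - r], makes it 0. *)
Lemma circle_eq_le s t : s <= t -> circle s = circle t ->
  exists n, t = s + T *+ n.
Proof.
move=> st est.
have cs : cos s = cos t.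
  have := congr1 (@cre R) est; rewrite !creE => /mulfI; apply; by rewrite gt_eqF.
have ss : sin s = sin t.
  have := congr1 (@cim R) est; rewrite !cimE => /mulfI; apply; by rewrite gt_eqF.
have c1 : cos (t - s) = 1 by rewrite cosB cs ss -!expr2 cos2Dsin2.
pose n := Num.truncn ((t - s) / T).
have /andP[n1 n2] : n%:R <= (t - s) / T < n.+1%:R.
  by apply: truncn_itv; rewrite divr_ge0 ?subr_ge0 // ltW // T_gt0.
rewrite ler_pdivlMr ?T_gt0 // in n1; rewrite ltr_pdivrMr ?T_gt0 // in n2.
pose r := t - s - T *+ n.
have rT : r = t - s - n%:R * T by rewrite /r -[T *+ n]mulr_natl.
have r0 : 0 <= r by rewrite rT subr_ge0.
have r1 : r < T by rewrite rT ltrBlDl; move: n2; rewrite -natr1 mulrDl mul1r.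
have cr : cos r = 1.
  have : circle (r + T *+ n) = circle r by rewrite circle_periodic.
  rewrite /r subrK => /(congr1 (@cre R)); rewrite !creE c1 => /mulfI h.
  by rewrite /r -h // gt_eqF.
have pi0 := pi_gt0 R.
have zpi : (0 : R) \in `[0, pi] by rewrite in_itv /= lexx ltW.
have r_eq0 : r = 0.
  have [rpi|pir] := leP r pi.
    by apply: cos_inj; rewrite ?cr ?cos0 // in_itv /= r0.
  have : T - r = 0.
    apply: cos_inj; rewrite ?cos0 // ?in_itv /=; first by rewrite mulr2n; lra.
    by rewrite -cosN opprB -[LHS]cosD2pi subrK cr.
  by lra.
by exists n; move: r_eq0; rewrite /r => h; lra.
Qed.

(** The quotient [v / circle t] is near 1, so it has positive real part and its argument is the
    arcsine of its imaginary part. The cap 1 on the distance secures the positivity. *)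
Lemma circle_surj_near t (a : R) : 0 < a -> exists2 d : R, 0 < d &
  forall v : C, cmod v = eps -> cmod (v - circle t) < d ->
    exists2 u, `|u - t| < a & v = circle u.
Proof.
move=> a0.
have asin0 : asin (0 : R) = 0.
  rewrite -[X in asin X](@sin0 R) sinK // in_itv /=.
  by have := pi_gt0 R; lra.
have : {for 0, continuous (@asin R)} by apply: continuous_asin; lra.
move=> /rcontinuousP/(_ a a0)[d d0 hd].
exists (eps * Num.min d 1); first by rewrite mulr_gt0 // lt_min d0 ltr01.
move=> v veps vt.
have ct0 : circle t != 0 by rewrite -cmod_gt0 cmod_circle.
pose w := v / circle t.
have w1 : cmod w = 1 by rewrite cmodM cmodV cmod_circle veps divff // gt_eqF.
have wd : cmod (w - 1) < Num.min d 1.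
  have -> : w - 1 = (v - circle t) / circle t by rewrite /w; field.
  by rewrite cmodM cmodV cmod_circle ltr_pdivrMr // mulrC.
move: wd; rewrite lt_min => /andP[wd w11].
have xy : cre w ^+ 2 + cim w ^+ 2 = 1.
  have := congr1 (fun x => x ^+ 2) w1.
  by rewrite /= cmodE sqr_sqrtr ?expr1n // addr_ge0 // sqr_ge0.
have x0 : 0 < cre w.
  by have := cre_le (w - 1); rewrite creB cre1 ler_norml => /andP[]; lra.
have yd : `|cim w| < d.
  by have := cim_le (w - 1); rewrite cimB cim1 subr0; lra.
have y1 : -1 <= cim w <= 1 by rewrite -ler_norml -w1 cim_le.
exists (t + asin (cim w)).
  by rewrite addrKC; have := hd (cim w); rewrite asin0 !subr0; apply.
rewrite circleD cos_asin // asinK ?in_itv //.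
have -> : Num.sqrt (1 - cim w ^+ 2) = cre w.
  have -> : 1 - cim w ^+ 2 = cre w ^+ 2 by lra.
  by rewrite sqrtr_sqr gtr0_norm.
by rewrite cpxE /w mulrC divfK.
Qed.

Lemma circle_surj (v : C) : cmod v = eps -> exists t, v = circle t.
Proof.
move=> veps.
have xy : cre v ^+ 2 + cim v ^+ 2 = eps ^+ 2.
  by rewrite -veps cmodE sqr_sqrtr // addr_ge0 // sqr_ge0.
pose x := cre v / eps.
have xE : cre v = eps * x by rewrite /x; field; rewrite gt_eqF.
have x1 : -1 <= x <= 1.
  have := cre_le v; rewrite veps xE normrM (gtr0_norm eps0) -ler_norml.
  by rewrite -[X in _ <= X]mulr1 ler_pM2l.
have s1 : eps * Num.sqrt (1 - x ^+ 2) = `|cim v|.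
  rewrite -[eps in LHS]gtr0_norm // -sqrtr_sqr -sqrtrM ?sqr_ge0 //.
  rewrite -sqrtr_sqr; congr Num.sqrt.
  have -> : cim v ^+ 2 = eps ^+ 2 - (eps * x) ^+ 2 by rewrite -xE -xy; ring.
  by ring.
have [y0|y0] := leP 0 (cim v).
  exists (acos x); apply: cpx_ext; rewrite ?creE ?cimE.
    by rewrite acosK ?in_itv.
  by rewrite sin_acos // s1 ger0_norm.
exists (- acos x); apply: cpx_ext; rewrite ?creE ?cimE ?cosN ?sinN.
  by rewrite acosK ?in_itv.
by rewrite sin_acos // mulrN s1 ltr0_norm // opprK.
Qed.

End Circle.

(** * Lifting the circle along the level curve *)

Section Connected.

(** Connectedness as an induction principle: both [P] and its negation spread to nearby points of
    [A]. *)
Lemma connected_forall (T : topologicalType) (A : set T) (P : T -> Prop) x0 :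
  connected A -> A x0 -> P x0 ->
  (forall x, A x -> P x -> \forall y \near x, A y -> P y) ->
  (forall x, A x -> ~ P x -> \forall y \near x, A y -> ~ P y) ->
  forall x, A x -> P x.
Proof.
move=> cA Ax0 Px0 oP cP.
have AP : A `&` [set x | P x] = A.
  apply: cA; first by exists x0.
  - exists (interior [set y | A y -> P y]); first exact: open_interior.
    apply/seteqP; split=> x [Ax Px]; split=> //; first exact: oP.
    by have := nbhs_singleton Px; apply.
  - exists (~` interior [set y | A y -> ~ P y]).
      by apply: open_closedC; exact: open_interior.
    apply/seteqP; split=> x [Ax Px]; split=> //.
      by move=> h; have := nbhs_singleton h; exact.
    by apply: contrapT => nP; apply: Px; exact: cP.
by move=> x; rewrite -{1}AP => -[].
Qed.

Lemma segment_forall (R : realType) (a b t : R) (P : R -> Prop) :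
  a <= t <= b -> P t ->
  (forall u, a <= u <= b -> P u -> exists2 d : R, 0 < d &
     forall v, a <= v <= b -> `|v - u| < d -> P v) ->
  (forall u, a <= u <= b -> ~ P u -> exists2 d : R, 0 < d &
     forall v, a <= v <= b -> `|v - u| < d -> ~ P v) ->
  forall u, a <= u <= b -> P u.
Proof.
move=> tab Pt oP cP u uab.
have := @connected_forall _ _ P t (@segment_connected R a b).
rewrite /= !in_itv => /(_ tab Pt); apply; last by rewrite in_itv.
  move=> x; rewrite in_itv /= => xab Px; have [d d0 hd] := oP x xab Px.
  apply/nbhs_ballP; exists d => // v; rewrite /ball /= => vx; rewrite in_itv.
  by move=> vab; apply: hd => //; rewrite distrC.
move=> x; rewrite in_itv /= => xab Px; have [d d0 hd] := cP x xab Px.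
apply/nbhs_ballP; exists d => // v; rewrite /ball /= => vx; rewrite in_itv.
by move=> vab; apply: hd => //; rewrite distrC.
Qed.

End Connected.

(** * Continuation along a level curve, separated from complex analysis by the hypotheses below *)

Section Flow.
Variables (R : realType) (eps : R) (f : Cplx R -> Cplx R) (L V : set (Cplx R)).
Notation C := (Cplx R).
Notation T := ((pi : R) *+ 2).
Notation e := (circle eps).
Hypothesis eps0 : 0 < eps.
Hypothesis cL : compact L.
Hypothesis connL : connected L.
Hypothesis VL : V `<=` L.
Hypothesis cf : forall z, L z -> ccont f z.
Hypothesis feps : forall z, L z -> cmod (f z) = eps.
Hypothesis isol : forall z, L z -> exists2 r : R, 0 < r &
  forall w, L w -> cmod (w - z) < r -> w != z -> f w != f z.
Hypothesis finV : finite_set V.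
(** Off [V], [L] is an arc parametrised by the argument of [f]. The cap [eta <= 1] makes parameters
    in one window differ by less than 2, hence by less than a period, so that the value of [f]
    determines them. *)
Hypothesis chart : forall p t, L p -> ~ V p -> f p = e t ->
  exists (eta r : R) (psi : R -> C), [/\ 0 < eta <= 1, 0 < r, psi t = p,
    forall u, `|u - t| < eta ->
      [/\ pcont psi u, f (psi u) = e u, L (psi u) & ~ V (psi u)] &
    forall y, L y -> cmod (y - p) < r -> exists2 u, `|u - t| < eta & y = psi u].

Implicit Types (p q y z : C) (t s u a b : R).

(** Unordered betweenness, so that forward and backward continuation share one theory. *)
Definition btw t s u := (t <= u <= s) || (s <= u <= t).

Lemma btwP t s u : btw t s u <-> Num.min t s <= u <= Num.max t s.
Proof. by rewrite /btw; case: (leP t s) => ts; split; lra. Qed.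

Lemma btwC t s u : btw t s u = btw s t u. Proof. by rewrite /btw orbC. Qed.
Lemma btwl t s : btw t s t. Proof. by rewrite /btw lexx; case: leP => //= /ltW ->. Qed.
Lemma btwr t s : btw t s s. Proof. by rewrite btwC btwl. Qed.

Lemma btw_sub t s t' s' u : btw t s t' -> btw t s s' -> btw t' s' u -> btw t s u.
Proof. by rewrite /btw; lra. Qed.

(** [g] is continuous on the whole line, but lies on [L] and lifts the circle only between [t] and
    [s]; lifts can thus be glued and restricted without subspace continuity. *)
Definition lifts t s (g : R -> C) := (forall u, pcont g u) /\
  forall u, btw t s u -> [/\ L (g u), ~ V (g u) & f (g u) = e u].

(* [flow p t s q]: continuing the branch of [f^-1 (e u)] through [p] at [u = t]
   along [L] away from [V] one reaches [q] at [u = s]. *)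
Definition flow p t s q := exists g, [/\ lifts t s g, g t = p & g s = q].

Lemma lifts_sub t s t' s' g : btw t s t' -> btw t s s' -> lifts t s g -> lifts t' s' g.
Proof. by move=> h1 h2 [cg hg]; split=> // u hu; apply: hg; exact: btw_sub hu. Qed.

Lemma lifts_flow t s t' s' g : btw t s t' -> btw t s s' -> lifts t s g ->
  flow (g t') t' s' (g s').
Proof. by move=> h1 h2 lg; exists g; split=> //; exact: lifts_sub lg. Qed.

Lemma flow_sym p t s q : flow p t s q -> flow q s t p.
Proof.
by move=> [g [[cg hg] <- <-]]; exists g; split=> //; split=> // u; rewrite btwC; exact: hg.
Qed.

Lemma flow_src p t s q : flow p t s q -> [/\ L p, ~ V p & f p = e t].
Proof. by move=> [g [[cg hg] <- _]]; apply: hg; exact: btwl. Qed.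

Lemma flow_tgt p t s q : flow p t s q -> [/\ L q, ~ V q & f q = e s].
Proof. by move=> /flow_sym/flow_src. Qed.

Lemma flow_refl p t : L p -> ~ V p -> f p = e t -> flow p t t p.
Proof.
move=> Lp Vp fp; exists (fun=> p); split=> //; split.
  by move=> u x x0; exists 1 => // s _; rewrite subrr cmod0.
move=> u; rewrite /btw orbb => utt; have -> : u = t by lra.
by split.
Qed.

Lemma circle_inj_near s t : `|s - t| < 2 -> e s = e t -> s = t.
Proof.
wlog st : s t / s <= t.
  move=> h; have [st|ts] := leP s t; first exact: h.
  by rewrite distrC => d /esym st; apply/esym; apply: h => //; exact: ltW.
move=> d /(circle_eq_le eps0 st)[[|n] tE]; first by rewrite tE mulr0n addr0.
have := pi_ge2 R; move: d; rewrite distrC tE addrKC ger0_norm; last first.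
  by rewrite mulrn_wge0 // ltW // T_gt0.
have : 0 <= T *+ n by rewrite mulrn_wge0 // ltW // T_gt0.
have -> : T *+ n.+1 = T *+ n + pi + pi by rewrite mulrSr [X in _ + X]mulr2n addrA.
by move: (T *+ n) => x; lra.
Qed.

Lemma chart_inj p t : L p -> ~ V p -> f p = e t -> exists2 r : R, 0 < r &
  forall y y', L y -> L y' -> cmod (y - p) < r -> cmod (y' - p) < r ->
    f y = f y' -> y = y'.
Proof.
move=> Lp Vp fp; have [eta [r [psi [/andP[eta0 eta1] r0 _ h1 h2]]]] := chart Lp Vp fp.
exists r => // y y' Ly Ly' yr yr'.
have [u ut ->] := h2 y Ly yr; have [u' ut' ->] := h2 y' Ly' yr'.
have [_ -> _ _] := h1 u ut; have [_ -> _ _] := h1 u' ut' => euu.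
congr psi; apply: circle_inj_near euu.
by have := ler_distD t u u'; rewrite [ `|t - u'|]distrC; lra.
Qed.

(** Agreement is an open condition because [f] is injective on [L] near a point off [V], and a
    closed one by continuity. *)
Lemma lifts_uniq t s g h : lifts t s g -> lifts t s h -> g t = h t ->
  forall u, btw t s u -> g u = h u.
Proof.
move=> [cg hg] [ch hh] ght u /btwP bu.
apply: (@segment_forall R _ _ t (fun u => g u = h u)) bu => //.
- exact/btwP/btwl.
- move=> {}u /btwP bu ghu; have [Lg Vg fg] := hg u bu.
  have [r r0 hr] := chart_inj Lg Vg fg.
  have [d1 d10 h1] := cg u r r0; have [d2 d20 h2] := ch u r r0.
  exists (Num.min d1 d2) => [|v /btwP bv]; first by rewrite lt_min d10.
  rewrite lt_min => /andP[/h1 {}h1 /h2]; rewrite -ghu => {}h2.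
  have [Lgv _ fgv] := hg v bv; have [Lhv _ fhv] := hh v bv.
  by apply: hr => //; rewrite fgv fhv.
- move=> {}u /btwP bu ghu; pose d := cmod (g u - h u) / 2.
  have d0 : 0 < d by rewrite divr_gt0 // cmod_gt0 subr_eq0; apply/eqP.
  have [d1 d10 h1] := cg u d d0; have [d2 d20 h2] := ch u d d0.
  exists (Num.min d1 d2) => [|v _]; first by rewrite lt_min d10.
  rewrite lt_min => /andP[/h1 {}h1 /h2 {}h2] ghv.
  have := cmod_tri (g u) (g v) (h u); rewrite [cmod (g u - g v)]cmodB {2}ghv.
  by rewrite /d in h1 h2; lra.
Qed.

Lemma flow_uniq p t s q q' : flow p t s q -> flow p t s q' -> q = q'.
Proof.
move=> [g [lg gt <-]] [h [lh ht <-]]; apply: (lifts_uniq lg lh); last exact: btwr.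
by rewrite gt ht.
Qed.

Lemma pcont_glue g h s : (forall u, pcont g u) -> (forall u, pcont h u) ->
  g s = h s -> forall u, pcont (fun u => if u <= s then g u else h u) u.
Proof.
move=> cg ch ghs u d d0.
have [d1 d10 h1] := cg u d d0; have [d2 d20 h2] := ch u d d0.
have [us|su|us] := ltgtP u s.
- exists (Num.min d1 (s - u)); first by rewrite lt_min d10 subr_gt0.
  move=> v; rewrite lt_min => /andP[/h1 {}h1]; rewrite ltr_norml => /andP[_ vs].
  have -> : v <= s by lra.
  by rewrite ?(ltW us).
- exists (Num.min d2 (u - s)); first by rewrite lt_min d20 subr_gt0.
  move=> v; rewrite lt_min => /andP[/h2 {}h2]; rewrite ltr_norml => /andP[vs _].
  have -> : (v <= s) = false by apply/negbTE; rewrite -ltNge; lra.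
  exact: h2.
- subst s; exists (Num.min d1 d2); first by rewrite lt_min d10.
  move=> v; rewrite lt_min => /andP[v1 v2].
  case: ifP => _; first exact: h1.
  by rewrite ghs; exact: h2.
Qed.

Lemma flow_glue p t s r q y : t <= s <= r -> flow p t s q -> flow q s r y ->
  flow p t r y.
Proof.
move=> /andP[ts sr] [g [[cg hg] gt gs]] [h [[ch hh] hs hr]].
exists (fun u => if u <= s then g u else h u); split.
- split; first by apply: pcont_glue => //; rewrite gs hs.
  move=> u bu; case: ifP => us.
    by apply: hg; move: bu us; rewrite /btw; lra.
  by apply: hh; move: bu us; rewrite /btw; lra.
- by rewrite ts.
- case: ifP => // rs; have rsE : r = s by lra.
  by rewrite rsE gs -hs -rsE.
Qed.

(** The three parameters may come in any order. When the second path retraces the first or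
    overshoots its start, uniqueness identifies them ([inner]); only when [s] lies in the middle are
    two lifts glued. *)
Lemma flow_trans p t s r q y : flow p t s q -> flow q s r y -> flow p t r y.
Proof.
have inner p' t' s' r' q' y' : btw t' s' r' ->
    flow p' t' s' q' -> flow q' s' r' y' -> flow p' t' r' y'.
  move=> b [g [lg gt gs]] h.
  have -> : y' = g r'; last by rewrite -gt; exact: lifts_flow (btwl _ _) b lg.
  apply: (flow_uniq h); rewrite -gs; exact: lifts_flow (btwr _ _) b lg.
move=> h1 h2.
have [b|nb1] := boolP (btw t s r); first exact: inner h1 h2.
have [b|nb2] := boolP (btw s r t).
  by apply: flow_sym; apply: inner (flow_sym h1); [rewrite btwC|exact: flow_sym h2].
have [ts|st] := leP t s.
  by apply: (flow_glue (s := s)) h1 h2; move: nb1 nb2; rewrite /btw; lra.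
apply: flow_sym; apply: (flow_glue (s := s)) (flow_sym h2) (flow_sym h1).
by move: nb1 nb2; rewrite /btw; lra.
Qed.

Lemma flow_btw p t s q u : btw t s u -> flow p t s q -> exists y, flow p t u y.
Proof.
by move=> b [g [lg <- _]]; exists (g u); exact: lifts_flow (btwl _ _) b lg.
Qed.

Lemma pcont_shift g c u : pcont g (u + c) -> pcont (fun u => g (u + c)) u.
Proof.
move=> cg d /cg[d' d'0 h]; exists d' => // v vu; apply: h.
by have -> : v + c - (u + c) = v - u by ring.
Qed.

Lemma flow_shift n p t s q : flow p (t + T *+ n) (s + T *+ n) q <-> flow p t s q.
Proof.
split=> [[g [[cg hg] gt gs]]|[g [[cg hg] gt gs]]].
  exists (fun u => g (u + T *+ n)); split=> //; split=> [u|u bu].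
    exact: pcont_shift.
  have [|? ? fg] := hg (u + T *+ n); first by move: bu; rewrite /btw; lra.
  by split=> //; rewrite fg circle_periodic.
exists (fun u => g (u + - (T *+ n))); split; rewrite ?addrK //; split=> [u|u bu].
  exact: pcont_shift.
have [|? ? fg] := hg (u + - (T *+ n)); first by move: bu; rewrite /btw; lra.
by split=> //; rewrite fg -(@circle_periodic _ eps _ n) subrK.
Qed.

(** Clamping the argument makes a chart, continuous only on its window, into a globally continuous
    function, as [lifts] demands. *)
Lemma pcont_clamp (g : R -> C) a b : a <= b -> (forall u, a <= u <= b -> pcont g u) ->
  forall u, pcont (fun u => g (Num.max a (Num.min b u))) u.
Proof.
move=> ab cg u d d0.
have [|d' d'0 h] := cg (Num.max a (Num.min b u)) _ d d0.
  by rewrite le_max lexx /= ge_max ab ge_min lexx.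
exists d' => // v vu; apply: h; apply: le_lt_trans vu.
have m1 : `|Num.min b v - Num.min b u| <= `|v - u|.
  by case: (leP b v) => ?; case: (leP b u) => ?; rewrite ?subrr ?normr0 //;
    rewrite ler_norml; have := ler_norm (v - u); have := ler_norm (u - v);
    rewrite [ `|u - v|]distrC; lra.
apply: le_trans m1; move: (Num.min b v) (Num.min b u) => x w.
by case: (leP a x) => ?; case: (leP a w) => ?; rewrite ?subrr ?normr0 //;
  rewrite ler_norml; have := ler_norm (x - w); have := ler_norm (w - x);
  rewrite [ `|w - x|]distrC; lra.
Qed.

(** The chart in terms of [flow]: with the same [eta], any nearby point can be continued across the
    whole window around [t], and every nearby point of [L] lies on the branch of [p]. *)
Lemma chart_flow p t : L p -> ~ V p -> f p = e t ->
  exists eta r : R, [/\ 0 < eta, 0 < r,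
    forall y s s', L y -> cmod (y - p) < r -> f y = e s ->
      `|s - t| < eta -> `|s' - t| < eta -> exists q, flow y s s' q &
    forall y, L y -> cmod (y - p) < r -> exists u, flow p t u y].
Proof.
move=> Lp Vp fp.
have [eta [r [psi [/andP[eta0 eta1] r0 psit h1 h2]]]] := chart Lp Vp fp.
have fl s s' : `|s - t| < eta -> `|s' - t| < eta -> flow (psi s) s s' (psi s').
  move=> st st'; pose a := Num.min s s'; pose b := Num.max s s'.
  have ab : a <= b by rewrite /a /b; case: (leP s s') => //; exact: ltW.
  have abt u : a <= u <= b -> `|u - t| < eta.
    move: st st'; rewrite !ltr_norml /a /b.
    by case: (leP s s') => ? /andP[? ?] /andP[? ?] /andP[? ?]; apply/andP; split; lra.
  have cl u : btw s s' u -> Num.max a (Num.min b u) = u.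
    move=> /btwP; rewrite -/a -/b => /andP[au ub].
    by rewrite (min_idPr ub) (max_idPr au).
  exists (fun u => psi (Num.max a (Num.min b u))); split.
  - split; first by apply: pcont_clamp => // u /abt/h1[].
    move=> u bu; rewrite cl //; have /btwP/abt/h1[_ fu Lu Vu] := bu.
    by split.
  - by rewrite cl // btwl.
  - by rewrite cl // btwr.
exists eta, r; split=> //.
- move=> y s s' Ly yr fy st st'.
  have [u ut yE] := h2 y Ly yr; have [_ fu _ _] := h1 u ut.
  have us : u = s.
    apply: circle_inj_near; last by rewrite -fu -yE.
    by have := ler_distD t u s; rewrite [ `|t - s|]distrC; lra.
  by exists (psi s'); rewrite yE us; exact: fl.
- move=> y Ly yr; have [u ut yE] := h2 y Ly yr; exists u.
  by rewrite yE -{1}psit; apply: fl => //; rewrite subrr normr0.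
Qed.

(** * Domains of branches, and closed orbits *)

Definition dom p t s := exists q, flow p t s q.

Lemma dom_flow p t s q s' : flow p t s q -> dom q s s' <-> dom p t s'.
Proof.
move=> h; split=> [[y hy]|[y hy]]; exists y; first exact: flow_trans hy.
exact: flow_trans (flow_sym h) hy.
Qed.

Lemma dom_open p t s : dom p t s -> exists2 d : R, 0 < d &
  forall s', `|s' - s| < d -> dom p t s'.
Proof.
move=> [q h]; have [Lq Vq fq] := flow_tgt h.
have [eta [r [eta0 r0 h1 _]]] := chart_flow Lq Vq fq.
exists eta => // s' s's.
have [||y hy] := h1 q s s' Lq _ fq _ s's; rewrite ?subrr ?cmod0 ?normr0 //.
by exists y; exact: flow_trans h hy.
Qed.

(** Several turns are allowed, since [f] may wrap the curve more than once around the circle. *)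
Definition closed_orbit p t := exists2 n, (0 < n)%N & flow p t (t + T *+ n) p.

(** Squares are taken because the value of [f] at the midpoint of an edge is known only up to
    sign. *)
Lemma sqr_fiber_finite (c : C) : finite_set (L `&` [set z | L z /\ f z ^+ 2 = c]).
Proof.
apply: compact_isolated_finite => // z Lz.
have [fz|fz] := eqVneq (f z ^+ 2) c.
  (* [isol] rules out [f w = f z], and continuity within [eps] rules out [f w = - f z], which is at
     distance [2 * eps]. *)
  have [r r0 hr] := isol Lz; have [d d0 hd] := cf Lz eps0.
  exists (Num.min r d) => [|w]; first by rewrite lt_min r0.
  rewrite lt_min => /andP[wr /hd wd] wz [Lw /eqP]; rewrite -fz eqf_sqr.
  rewrite (negbTE (hr w Lw wr wz)) /= => /eqP fw.
  move: wd; rewrite fw -opprD cmodN.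
  have -> : f z + f z = (2 : R)%:C%C * f z by rewrite rmorph_nat; ring.
  rewrite cmodM cmod_real feps // ger0_norm //.
  by have := eps0; lra.
have cf2 : ccont (fun w => f w * f w) z by apply: ccontM; exact: cf.
have d0 : 0 < cmod (c - f z ^+ 2) by rewrite cmod_gt0 subr_eq0 eq_sym.
have [d dd hd] := cf2 _ d0; exists d => // w /hd + _ [_ fw].
by rewrite -!expr2 fw ltxx.
Qed.

Lemma fiber_pigeonhole (c : C) (q : nat -> C) : (forall n, L (q n) /\ f (q n) = c) ->
  exists i j, (i < j)%N /\ q i = q j.
Proof.
move=> hq; have /finite_seqP[s sE] := sqr_fiber_finite (c ^+ 2).
apply: contrapT => nij.
have qinj : injective q.
  move=> i j qij; apply: contrapT => /eqP; rewrite neq_ltn => /orP[ij|ij]; apply: nij.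
    by exists i, j.
  by exists j, i.
have : (size (map q (iota 0 (size s).+1)) <= size s)%N.
  apply: uniq_leq_size; first by rewrite map_inj_uniq // iota_uniq.
  move=> _ /mapP[n _ ->]; have [Lq fq] := hq n.
  suff : [set` s] (q n) by [].
  by rewrite -sE; split=> //; split=> //; rewrite fq.
by rewrite size_map size_iota ltnn.
Qed.

(** The points reached after whole turns all lie in one finite fiber, so two of them coincide, and
    the stretch between them closes up. *)
Lemma unbounded_up p t : (forall n, dom p t (t + T *+ n)) ->
  exists q s, closed_orbit q s.
Proof.
move=> /boolp.choice[q hq].
have [|i [j [ij qij]]] := @fiber_pigeonhole (f p) q.
  move=> n; have [Lq _ fq] := flow_tgt (hq n); split=> //.
  by rewrite fq circle_periodic; have [] := flow_src (hq n).
exists (q i), (t + T *+ i), (j - i)%N; first by rewrite subn_gt0.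
rewrite -addrA -mulrnDr subnKC; last exact: ltnW.
by apply: flow_trans (flow_sym (hq i)) _; rewrite qij.
Qed.

Lemma unbounded_dn p t : (forall n, dom p t (t - T *+ n)) ->
  exists q s, closed_orbit q s.
Proof.
move=> /boolp.choice[q hq].
have [|i [j [ij qij]]] := @fiber_pigeonhole (f p) q.
  move=> n; have [Lq _ fq] := flow_tgt (hq n); split=> //.
  rewrite fq -(@circle_periodic _ eps _ n) subrK.
  by have [] := flow_src (hq n).
exists (q i), (t - T *+ j), (j - i)%N; first by rewrite subn_gt0.
have -> : t - T *+ j + T *+ (j - i) = t - T *+ i.
  by rewrite mulrnBr ?(ltnW ij) //; ring.
by rewrite {1}qij; exact: flow_trans (flow_sym (hq j)) (hq i).
Qed.

Lemma orbit_iter p t n k : flow p t (t + T *+ n) p -> flow p t (t + T *+ (n * k)) p.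
Proof.
move=> h; elim: k => [|k ih].
  by rewrite muln0 mulr0n addr0; have [? ? ?] := flow_src h; exact: flow_refl.
rewrite mulnS addnC mulrnDr addrA; apply: flow_trans ih _.
have -> : t + T *+ (n * k) + T *+ n = t + T *+ n + T *+ (n * k) by ring.
exact/flow_shift.
Qed.

Lemma orbit_reduce p t n s y : (0 < n)%N -> flow p t (t + T *+ n) p -> flow p t s y ->
  exists2 s', t <= s' <= t + T *+ n & flow p t s' y.
Proof.
move=> n0 h; have Tn0 : 0 < T *+ n by rewrite pmulrn_lgt0 // T_gt0.
wlog st : s / t <= s.
  move=> wl hs; have [st|st] := leP t s; first exact: wl hs.
  pose k := (Num.truncn ((t - s) / (T *+ n))).+1.
  have : (t - s) / (T *+ n) < k%:R by exact: truncnS_gt.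
  rewrite ltr_pdivrMr // mulr_natl -mulrnA => hk.
  apply: (wl (s + T *+ (n * k))); first by lra.
  by apply: flow_trans (orbit_iter k h) _; exact/flow_shift.
move=> hs; pose k := Num.truncn ((s - t) / (T *+ n)).
have /andP[k1 k2] : k%:R <= (s - t) / (T *+ n) < k.+1%:R.
  by apply: truncn_itv; rewrite divr_ge0 ?subr_ge0 // ltW.
rewrite ler_pdivlMr // mulr_natl -mulrnA in k1.
rewrite ltr_pdivrMr // mulr_natl -mulrnA mulnS mulrnDr in k2.
exists (s - T *+ (n * k)); first by lra.
apply/(@flow_shift (n * k)); rewrite subrK.
exact: flow_trans (flow_sym (orbit_iter k h)) hs.
Qed.

Lemma image_compact (g : R -> C) a b : (forall u, pcont g u) -> compact (g @` `[a, b]).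
Proof.
move=> cg; apply: continuous_compact; last exact: segment_compact.
by apply: continuous_subspaceT => u; apply/pcontP.
Qed.

(** Openness in [L] comes from [chart_flow]: a nearby point is reached by the flow, possibly outside
    the period, and [orbit_reduce] brings its parameter back. *)
Lemma closed_orbit_all p t n (g : R -> C) : (0 < n)%N ->
  lifts t (t + T *+ n) g -> g t = p -> g (t + T *+ n) = p -> L = g @` `[t, t + T *+ n].
Proof.
move=> n0 lg gt gn; have Tn0 : 0 <= T *+ n by rewrite mulrn_wge0 // ltW // T_gt0.
have bt u : t <= u <= t + T *+ n -> btw t (t + T *+ n) u by rewrite /btw => ->.
have h : flow p t (t + T *+ n) p by exists g.
have gE s y : flow p t s y -> (g @` `[t, t + T *+ n]) y.
  move=> /(orbit_reduce n0 h)[s' s't hs']; exists s' => /=; first by rewrite in_itv.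
  apply: flow_uniq hs'; rewrite -gt.
  by apply: lifts_flow lg; [exact: btwl|exact: bt].
have [cg hg] := lg.
apply/seteqP; split; last first.
  by move=> _ [u /= + <-]; rewrite in_itv /= => /bt/hg[].
have Lp : L p by have [] := flow_src h.
apply: (connected_forall connL Lp); first by exists t; rewrite //= in_itv /= lexx lerDl.
  move=> x Lx [u /=]; rewrite in_itv /= => ut gu.
  have [Lu Vu fu] := hg u (bt u ut); rewrite gu in Lu Vu fu.
  have [eta [r [eta0 r0 _ h2]]] := chart_flow Lu Vu fu.
  apply/nbhs_cmod; exists r => // y yr Ly; have [s hs] := h2 y Ly yr.
  apply: (gE s); apply: flow_trans hs; rewrite -gt -gu.
  by apply: lifts_flow lg; [exact: btwl|exact: bt].
move=> x Lx nx.
have cK : closed (g @` `[t, t + T *+ n]).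
  by apply: compact_closed; [exact: norm_hausdorff|exact: image_compact].
have : nbhs x (~` (g @` `[t, t + T *+ n])).
  by apply: open_nbhs_nbhs; split=> //; exact: closed_openC.
by apply: filterS => y + _.
Qed.

(** The least number [n] of turns gives injectivity: a coincidence within the period means [m] turns
    with [0 < m < n], and transporting this loop back to [p] contradicts minimality. [V] is empty
    because the lift covers [L] and avoids [V]. *)
Lemma closed_orbit_circle p t : closed_orbit p t -> simple_closed_path L /\ V = set0.
Proof.
move=> [n0 n00 h0].
pose P := [pred n | (0 < n)%N && `[< flow p t (t + T *+ n) p >]].
have exP : exists n, P n by exists n0; rewrite /= n00; apply/asboolP.
have [n /andP[npos /asboolP h] minn] := ex_minnP exP.
have Tn0 : 0 < T *+ n by rewrite pmulrn_lgt0 // T_gt0.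
have [g [lg gt gn]] := h; have LE := closed_orbit_all npos lg gt gn.
have [cg hg] := lg.
have bt u : t <= u <= t + T *+ n -> btw t (t + T *+ n) u by rewrite /btw => ->.
split; last first.
  rewrite -subset0 => z Vz; have := VL Vz; rewrite LE => -[u /=].
  rewrite in_itv /= => /bt/hg[_ + _] gz; rewrite gz; exact.
exists (fun x => g (t + x * (T *+ n))); split.
- apply: continuous_subspaceT => x; apply/pcontP => d d0.
  have [d' d'0 hd] := cg (t + x * (T *+ n)) d d0.
  exists (d' / (T *+ n)); first by rewrite divr_gt0.
  move=> y yx; apply: hd.
  have -> : t + y * (T *+ n) - (t + x * (T *+ n)) = (y - x) * (T *+ n) by ring.
  by rewrite normrM (gtr0_norm Tn0) -ltr_pdivlMr.
- by rewrite mul0r addr0 mul1r gt gn.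
- move=> x y; rewrite !in_itv /=.
  wlog xy : x y / x <= y.
    move=> wl x01 y01 gxy; have [xy|yx] := leP x y; first exact: wl.
    by apply/esym; apply: wl => //; exact: ltW.
  move=> x01 y01; set u := t + x * _; set v := t + y * _ => guv.
  have ut : t <= u <= t + T *+ n by rewrite /u; nra.
  have vt : t <= v <= t + T *+ n by rewrite /v; nra.
  have [Lu Vu fu] := hg u (bt u ut); have [Lv Vv fv] := hg v (bt v vt).
  have uv : u <= v by rewrite /u /v; nra.
  have [|m vE] := circle_eq_le eps0 uv; first by rewrite -fu -fv guv.
  have [m0|mpos] := posnP m.
    move: vE; rewrite m0 mulr0n addr0 /u /v => /addrI /mulIf -> //.
    by rewrite gt_eqF.
  have mn : (m < n)%N.
    have : T *+ m < T *+ n.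
      by have <- : v - u = T *+ m; [rewrite vE addrKC|rewrite /u /v; nra].
    by rewrite ltr_pMn2l // T_gt0.
  have fu' : flow p t u (g u) by rewrite -gt; apply: lifts_flow lg; [exact: btwl|exact: bt].
  have fuv : flow (g u) u (u + T *+ m) (g u).
    by rewrite -vE {2}guv; exact: (lifts_flow (bt u ut) (bt v vt) lg).
  have : P m.
    rewrite /= mpos; apply/asboolP; apply: (flow_trans fu').
    by apply: (flow_trans fuv); apply/flow_shift; exact: flow_sym.
  by move=> /minn; rewrite leqNgt mn.
- rewrite LE; apply/seteqP; split=> z [u /=]; rewrite in_itv /= => ut <-.
    exists ((u - t) / (T *+ n)); last by rewrite divfK ?gt_eqF // subrKC.
    by rewrite /= in_itv /= divr_ge0 ?ler_pdivrMr ?mul1r //; lra.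
  by exists (t + u * (T *+ n)); rewrite //= in_itv /=; nra.
Qed.

Lemma closure_btw t b : b != t -> closure [set s | btw t b s /\ s != b] b.
Proof.
move=> bt A /nbhs_ballP[d /= d0 hd].
have [tb|tb] := ltP t b.
  pose x := Num.max t (b - d / 2); exists x; split.
    by rewrite /= /btw /x; case: (leP t (b - d / 2)) => h; split;
      rewrite ?lt_eqF //; lra.
  apply: hd; rewrite /ball /= ltr_norml /x.
  by case: (leP t (b - d / 2)) => h; lra.
have {bt}tb : b < t by rewrite lt_neqAle bt.
pose x := Num.min t (b + d / 2); exists x; split.
  by rewrite /= /btw /x; case: (leP t (b + d / 2)) => h; split;
    rewrite ?gt_eqF //; lra.
apply: hd; rewrite /ball /= ltr_norml /x.
by case: (leP t (b + d / 2)) => h; lra.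
Qed.

(* A cluster point of the branch at [b] lies in [V], as otherwise the branch could
   be continued to [b]; it is a limit since the points of the fiber over [e b] are
   isolated. *)
Lemma end_limit p t b : b != t ->
  (forall s, btw t b s -> s != b -> dom p t s) -> ~ dom p t b ->
  exists v, [/\ V v, f v = e b & forall d : R, 0 < d ->
    exists2 d' : R, 0 < d' & forall s q, btw t b s -> s != b -> `|s - b| < d' ->
      flow p t s q -> cmod (q - v) < d].
Proof.
move=> bt hD nD.
have /boolp.choice[G hG] s : exists q, dom p t s -> flow p t s q.
  by have [[q hq]|h] := pselect (dom p t s); [exists q|exists p => /h].
pose S := [set s | btw t b s /\ s != b].
have hGS s : S s -> flow p t s (G s) by move=> [bs sb]; apply: hG; exact: hD.
have PF : ProperFilter (within S (nbhs b)).
  by apply: within_nbhs_proper; exact: closure_btw.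
have FL : (G @ within S (nbhs b)) L.
  apply/nbhs_ballP; exists 1 => [|s _ /hGS/flow_tgt[]//]; exact: ltr01.
have [q0 [Lq0 clq0]] := cL (fmap_proper_filter G PF) FL.
have cl x d : 0 < x -> 0 < d ->
    exists s, [/\ S s, `|s - b| < d & cmod (G s - q0) < x].
  move=> x0 d0.
  have FA : (G @ within S (nbhs b)) [set y | exists2 s, S s /\ `|s - b| < d & y = G s].
    apply/nbhs_ballP; exists d => [//|s]; rewrite /ball /= distrC => sb Ss.
    by exists s.
  have nB : nbhs q0 [set y | cmod (y - q0) < x] by apply/nbhs_cmod; exists x.
  by have [_ [[s [Ss sb] ->] sx]] := clq0 _ _ FA nB; exists s.
have fq0 : f q0 = e b.
  apply/eqP; apply: contrapT => /negP; rewrite -subr_eq0 -cmod_gt0 => h0.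
  have h20 := divr_gt0 h0 (ltr0n R 2).
  have [d1 d10 h1] := cf Lq0 h20; have [d2 d20 h2] := circle_cont eps0 b h20.
  have [s [Ss /h2 sb /h1 sq]] := cl _ _ d10 d20.
  have [_ _ fG] := flow_tgt (hGS s Ss); rewrite fG in sq.
  have := cmod_tri (f q0) (e s) (e b); rewrite [cmod (f q0 - e s)]cmodB.
  by lra.
have Vq0 : V q0.
  apply: contrapT => Vq0.
  have [eta [r [eta0 r0 h1 _]]] := chart_flow Lq0 Vq0 fq0.
  have [s [Ss sb sq]] := cl _ _ r0 eta0.
  have fs := hGS s Ss; have [LG _ fG] := flow_tgt fs.
  have [|y hy] := h1 (G s) s b LG sq fG sb; first by rewrite subrr normr0.
  by apply: nD; exists y; exact: flow_trans hy.
exists q0; split=> // d d0.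
have [r r0 hr] := isol Lq0.
(* As [x < r], the circle of radius [x] about [q0] meets [L] in no point of the fiber over [e b]; by
   compactness [f] stays at a distance [m] from [e b] there. *)
pose x := Num.min d (r / 2).
have x0 : 0 < x by rewrite lt_min d0 divr_gt0.
have [xd xr] : x <= d /\ x < r.
  have : x <= r / 2 by rewrite ge_min lexx orbT.
  by move=> h; split; [rewrite ge_min lexx|lra].
pose K := L `&` [set y | cmod (y - q0) = x].
have [m m0 hm] : exists2 m : R, 0 < m & forall y, K y -> m <= cmod (f y - e b).
  have [K0|nK] := pselect (K !=set0); last by exists 1 => // y Ky; case: nK; exists y.
  have cK : compact K.
    apply: (subclosed_compact _ cL); last by move=> y [].
    apply: closedI; first by apply: compact_closed => //; exact: norm_hausdorff.
    apply: closed_cmod => z hz; apply/eqP; rewrite /= -subr_eq0 -normr_eq0.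
    rewrite eq_le normr_ge0 andbT leNgt; apply/negP => h.
    have [w /= wx wz] := hz _ h.
    move: wz; rewrite -wx ltNge => /negP; apply.
    have := cmod_tri z w q0; have := cmod_tri w z q0.
    by rewrite [cmod (z - w)]cmodB ler_norml; lra.
  have [|y /set_mem[Ly /= yx] hy] := @compact_EVT_min _ R (fun y => cmod (f y - e b)) K K0 cK.
    by apply: continuous_in_subspaceT => y /set_mem[Ly _]; exact/ccont_dist/cf.
  exists (cmod (f y - e b)) => [|y' Ky']; last by apply: hy; apply/mem_set.
  rewrite cmod_gt0 subr_eq0 -fq0; apply: hr; rewrite ?yx //.
  by apply/eqP => yq; move: yx; rewrite yq subrr cmod0; lra.
have [d1 d10 h1] := circle_cont eps0 b m0.
have [s0 [Ss0 s0b s0q]] := cl _ _ x0 d10.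
have [b0 nb0] := Ss0.
(* From [s0] towards [b] the value [e u] is within [m] of [e b], so the branch, inside the circle of
   radius [x] at [s0], cannot cross it. *)
exists `|s0 - b|; first by rewrite normr_gt0 subr_eq0.
move=> s q bs sb ss0 fs; apply: lt_le_trans xd.
have [g [lg gt gs]] := fs.
have bs0 : btw t s s0.
  move: bs b0 ss0; rewrite /btw ltr_norml => bs b0.
  by case: (leP s0 b) => h; [rewrite ler0_norm|rewrite ger0_norm]; lra.
have gs0 : g s0 = G s0.
  apply: (flow_uniq _ (hGS s0 Ss0)); rewrite -gt.
  by apply: lifts_flow lg => //; exact: btwl.
have [cg hg] := lg.
have bsub u : btw s0 s u -> btw t s u by move: bs0; rewrite /btw; lra.
have near_b u : btw s0 s u -> `|u - b| < d1.
  move=> bu; apply: le_lt_trans s0b; move: bu bs b0 ss0; rewrite /btw => bu bs b0.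
  by rewrite ltr_norml ler_norml; case: (leP s0 b) => h;
    [rewrite ler0_norm|rewrite ger0_norm]; lra.
have gx u : btw s0 s u -> cmod (g u - q0) <> x.
  move=> bu gx; have [Lu _ fu] := hg u (bsub u bu).
  have := hm (g u) (conj Lu gx); rewrite fu.
  by have := h1 u (near_b u bu); lra.
have /btwP bss := btwr s0 s; rewrite -gs.
apply: (@segment_forall R _ _ s0 (fun u => cmod (g u - q0) < x)) bss.
- exact/btwP/btwl.
- by rewrite gs0.
- move=> u /btwP bu gu; have h : 0 < x - cmod (g u - q0) by rewrite subr_gt0.
  have [d2 d20 h2] := cg u _ h; exists d2 => // v _ /h2.
  by have := cmod_tri (g v) (g u) q0; lra.
- move=> u /btwP bu /negP; rewrite -leNgt le_eqVlt => /orP[/eqP xg|xg].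
    by case: (gx u bu).
  have h : 0 < cmod (g u - q0) - x by rewrite subr_gt0.
  have [d2 d20 h2] := cg u _ h; exists d2 => // v _ /h2.
  by have := cmod_tri (g u) (g v) q0; rewrite [cmod (g u - g v)]cmodB; lra.
Qed.

Lemma open_ray (A : R -> Prop) t M : A t ->
  (forall s u, A s -> t <= u <= s -> A u) ->
  (forall s, A s -> exists2 d : R, 0 < d & forall s', `|s' - s| < d -> A s') ->
  ~ A M -> t <= M ->
  exists2 b, t < b & forall s, t <= s -> A s <-> s < b.
Proof.
move=> At cA oA nM tM; pose B := [set s | t <= s /\ A s].
have ubM : ubound B M.
  move=> s [ts As]; rewrite leNgt; apply/negP => Ms; apply: nM; apply: (cA s) => //.
  by rewrite tM ltW.
have Bt : B t by [].
have supB : has_sup B by split; [exists t|exists M].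
have sub s : A s -> t <= s -> s < sup B.
  move=> As ts; have [d d0 hd] := oA s As.
  have : s + d / 2 <= sup B.
    apply: ub_le_sup; first by exists M.
    split; first by lra.
    by apply: hd; rewrite addrKC gtr0_norm; lra.
  by lra.
exists (sup B); first exact: sub.
move=> s ts; split=> [As|sb]; first exact: sub.
have sb0 : 0 < sup B - s by rewrite subr_gt0.
have [s' [ts' As']] := sup_adherent sb0 supB.
by rewrite opprB subrKC => ss'; apply: (cA s') => //; lra.
Qed.

(** * Edges and their midpoints, in the absence of closed orbits *)

Hypothesis no_closed_orbit : forall q s, ~ closed_orbit q s.

Lemma dom_interval p t : L p -> ~ V p -> f p = e t ->
  exists a b, a < t < b /\ forall s, dom p t s <-> a < s < b.
Proof.
move=> Lp Vp fp; have Dt : dom p t t by exists p; exact: flow_refl.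
have [n1 hn1] : exists n, ~ dom p t (t + T *+ n).
  apply: contrapT => h; have [|q [s /no_closed_orbit//]] := @unbounded_up p t.
  by move=> n; apply: contrapT => hn; apply: h; exists n.
have [n2 hn2] : exists n, ~ dom p t (t - T *+ n).
  apply: contrapT => h; have [|q [s /no_closed_orbit//]] := @unbounded_dn p t.
  by move=> n; apply: contrapT => hn; apply: h; exists n.
have Tn n : 0 <= T *+ n by rewrite mulrn_wge0 // ltW // T_gt0.
have [|||b tb hb] := @open_ray (dom p t) t (t + T *+ n1) Dt _ _ hn1.
- by move=> s u [q hq] tus; apply: flow_btw hq; rewrite /btw tus.
- exact: dom_open.
- by rewrite lerDl.
(* The lower end is the upper end of the domain reflected by [s] to [- s]. *)
have [|||||a ta ha] := @open_ray (fun s => dom p t (- s)) (- t) (- (t - T *+ n2)).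
- by rewrite opprK.
- move=> s u [q hq] tus; apply: flow_btw hq; rewrite /btw; lra.
- move=> s /dom_open[d d0 hd]; exists d => // s' s's; apply: hd.
  by rewrite -normrN (_ : - (- s' - - s) = s' - s) //; ring.
- by rewrite opprK.
- by rewrite lerN2 gerBl.
exists (- a), b; split; first by apply/andP; split; lra.
move=> s; have [ts|st] := leP t s.
  by rewrite (hb s ts); split=> [->|/andP[]//]; rewrite andbT; lra.
have := ha (- s); rewrite opprK => ->; last by lra.
by split=> [h|/andP[h _]]; [apply/andP; split; lra|lra].
Qed.

(** Values of the branch come from different lifts. Since the domain is open, one lift on each side
    of [s] covers all nearby parameters, and uniqueness identifies the branch with it. *)
Lemma flow_cont p t s q : flow p t s q -> forall d : R, 0 < d ->
  exists2 d' : R, 0 < d' & forall s' q', `|s' - s| < d' -> flow p t s' q' ->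
    cmod (q' - q) < d.
Proof.
move=> h d d0; have Ds : dom p t s by exists q.
have [x x0 hx] := dom_open Ds.
have /hx/(dom_flow _ h)[y1 [g1 [l1 g1s _]]] : `|s + x / 2 - s| < x.
  by rewrite addrKC gtr0_norm; lra.
have /hx/(dom_flow _ h)[y2 [g2 [l2 g2s _]]] : `|s - x / 2 - s| < x.
  by rewrite addrKC normrN gtr0_norm; lra.
have [d1 d10 h1] := l1.1 s d d0; have [d2 d20 h2] := l2.1 s d d0.
exists (Num.min (x / 2) (Num.min d1 d2)); first by rewrite !lt_min divr_gt0 // d10.
move=> s' q'; rewrite !lt_min => /andP[sx /andP[s1 s2]] h'.
have hq := flow_trans (flow_sym h) h'.
move: sx; rewrite ltr_norml => /andP[sx1 sx2].
have [ss'|s's] := leP s s'.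
  have -> : q' = g1 s'.
    apply: (flow_uniq hq); rewrite -g1s; apply: lifts_flow l1; first exact: btwl.
    by rewrite /btw; lra.
  by rewrite -g1s; exact: h1.
have -> : q' = g2 s'.
  apply: (flow_uniq hq); rewrite -g2s; apply: lifts_flow l2; first exact: btwl.
  by rewrite /btw; lra.
by rewrite -g2s; exact: h2.
Qed.

(** Two parameters of one point differ by whole turns, so a difference would make a closed orbit. *)
Lemma flow_inj p t s s' q : flow p t s q -> flow p t s' q -> s = s'.
Proof.
wlog ss : s s' / s <= s'.
  move=> h h1 h2; have [ss|ss] := leP s s'; first exact: h.
  by apply/esym; apply: h h2 h1; exact: ltW.
move=> h1 h2; have [_ _ f1] := flow_tgt h1; have [_ _ f2] := flow_tgt h2.
have [|n sE] := circle_eq_le eps0 ss; first by rewrite -f1 -f2.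
have [n0|n0] := posnP n; first by rewrite sE n0 mulr0n addr0.
case: (@no_closed_orbit q s); exists n => //.
by rewrite -sE; exact: flow_trans (flow_sym h1) h2.
Qed.

Lemma flow_edge p t a b : a < t < b -> (forall s, dom p t s <-> a < s < b) ->
  exists g, [/\ is_edge V g, f (g 0) = e a, f (g 1) = e b,
    forall x, 0 < x < 1 -> flow p t (a + (b - a) * x) (g x) &
    forall q s, flow p t s q -> exists2 x, 0 < x < 1 & g x = q].
Proof.
move=> /andP[lat ltb] hD.
have ba0 : 0 < b - a by lra.
have [va [Vva fva la]] : exists v, [/\ V v, f v = e a & forall d : R, 0 < d ->
    exists2 d' : R, 0 < d' & forall s q, btw t a s -> s != a -> `|s - a| < d' ->
      flow p t s q -> cmod (q - v) < d].
  apply: end_limit; first by rewrite lt_eqF.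
    move=> s bs sa; apply/hD; have : a != s by rewrite eq_sym.
    by rewrite neq_lt; move: bs; rewrite /btw => ? /orP[?|?]; lra.
  by move/hD; lra.
have [vb [Vvb fvb lb]] : exists v, [/\ V v, f v = e b & forall d : R, 0 < d ->
    exists2 d' : R, 0 < d' & forall s q, btw t b s -> s != b -> `|s - b| < d' ->
      flow p t s q -> cmod (q - v) < d].
  apply: end_limit; first by rewrite gt_eqF.
    move=> s bs sb; apply/hD; move: sb.
    by rewrite neq_lt; move: bs; rewrite /btw => ? /orP[?|?]; lra.
  by move/hD; lra.
have /boolp.choice[G hG] s : exists q, dom p t s -> flow p t s q.
  by have [[q hq]|h] := pselect (dom p t s); [exists q|exists p => /h].
pose c x := a + (b - a) * x.
have cD x : 0 < x < 1 -> dom p t (c x) by move=> ?; apply/hD; rewrite /c; nra.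
(* The end values continue [g] outside the unit interval, making continuity at 0 and 1 two-sided as
   [pcont] asks. *)
pose g x := if x <= 0 then va else if 1 <= x then vb else G (c x).
have gG x : 0 < x < 1 -> g x = G (c x).
  by move=> /andP[x0 x1]; rewrite /g [x <= 0]leNgt x0 [1 <= x]leNgt x1.
have gflow x : 0 < x < 1 -> flow p t (c x) (g x).
  by move=> x01; rewrite gG //; apply: hG; exact: cD.
have g0 : g 0 = va by rewrite /g lexx.
have g1 : g 1 = vb by rewrite /g [1 <= 0]leNgt ltr01 lexx.
have ginj (x y : R) : 0 < x < 1 -> 0 < y < 1 -> g x = g y -> x = y.
  move=> x01 y01 gxy; have := gflow y y01; rewrite -gxy => h.
  by have /addrI /mulfI := flow_inj (gflow x x01) h; apply; rewrite gt_eqF.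
have cB (x y : R) : c x - c y = (b - a) * (x - y) by rewrite /c; ring.
have cont x : 0 <= x <= 1 -> pcont g x.
  move=> x01 d d0.
  have [x_0|xn0] := eqVneq x 0.
    have [d' d'0 h] := la d d0.
    (* The three bounds keep [y] below 1, keep [c y] on the side of [t] where the limit at [a] was
       established, and bring it within [d'] of [a]. *)
    exists (Num.min (Num.min 1 ((t - a) / (b - a))) (d' / (b - a))).
      by rewrite !lt_min ltr01 !divr_gt0 // subr_gt0.
    move=> y; rewrite x_0 subr0 !lt_min => /andP[/andP[y1 y2] y3].
    rewrite g0; have [y0|y0] := leP y 0; first by rewrite /g y0 subrr cmod0.
    rewrite gtr0_norm // in y1 y2 y3.
    have y01 : 0 < y < 1 by rewrite y0.
    rewrite ltr_pdivlMr // mulrC in y2; rewrite ltr_pdivlMr // mulrC in y3.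
    have y4 : 0 < (b - a) * y by rewrite mulr_gt0.
    apply: (h (c y)); last exact: gflow.
    - by rewrite /btw /c; lra.
    - by rewrite gt_eqF // /c; lra.
    - by rewrite /c addrKC gtr0_norm.
  have [x_1|xn1] := eqVneq x 1.
    have [d' d'0 h] := lb d d0.
    exists (Num.min (Num.min 1 ((b - t) / (b - a))) (d' / (b - a))).
      by rewrite !lt_min ltr01 !divr_gt0 // subr_gt0.
    move=> y; rewrite x_1 !lt_min => /andP[/andP[y1 y2] y3].
    rewrite g1; have [y0|y0] := leP 1 y.
      by rewrite /g y0 [y <= 0]leNgt (lt_le_trans ltr01 y0) subrr cmod0.
    rewrite distrC gtr0_norm ?subr_gt0 // in y1 y2 y3.
    have y01 : 0 < y < 1 by lra.
    rewrite ltr_pdivlMr // mulrC in y2; rewrite ltr_pdivlMr // mulrC in y3.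
    have y4 : 0 < (b - a) * (1 - y) by rewrite mulr_gt0 // subr_gt0.
    have cE : c y = b - (b - a) * (1 - y) by rewrite /c; ring.
    apply: (h (c y)); last exact: gflow.
    - by rewrite /btw cE; lra.
    - by rewrite lt_eqF // cE; lra.
    - by rewrite cE addrKC normrN gtr0_norm.
  have x01' : 0 < x < 1 by rewrite !lt_neqAle eq_sym xn0 xn1.
  have [d' d'0 h] := flow_cont (gflow x x01') d0.
  exists (Num.min (Num.min x (1 - x)) (d' / (b - a))).
    by rewrite !lt_min divr_gt0 // subr_gt0; case/andP: x01' => -> ->.
  move=> y; rewrite !lt_min => /andP[/andP[y1 y2] y3].
  have y01 : 0 < y < 1 by move: y1 y2; rewrite !ltr_norml; lra.
  apply: (h (c y)); last exact: gflow.
  by rewrite cB normrM gtr0_norm // mulrC -ltr_pdivlMr.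
exists g; split=> //.
- split.
  + apply: continuous_in_subspaceT => x /set_mem /=; rewrite in_itv /= => x01.
    exact/pcontP/cont.
  + by rewrite g0 g1.
  + by move=> x y; rewrite !in_itv /=; exact: ginj.
  + by move=> x; rewrite in_itv /= => /gflow/flow_tgt[].
- by rewrite g0.
- by rewrite g1.
- move=> q s hs; have /hD/andP[as_ sb] : dom p t s by exists q.
  have x01 : 0 < (s - a) / (b - a) < 1.
    apply/andP; split; first by rewrite divr_gt0 // subr_gt0.
    by rewrite ltr_pdivrMr // mul1r; lra.
  exists ((s - a) / (b - a)) => //; apply: flow_uniq (gflow _ x01) _.
  by rewrite /c mulrC divfK ?gt_eqF // subrKC.
Qed.

(** The branch through [q] extends equally far both ways. This singles out one point of each edge
    independently of where the continuation started, so midpoints can serve as indices of edges. *)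
Definition is_mid q t := [/\ L q, ~ V q, f q = e t &
  exists2 h : R, 0 < h & forall s, dom q t s <-> `|s - t| < h].

Lemma mid_exists p t : L p -> ~ V p -> f p = e t ->
  exists q s, flow p t s q /\ is_mid q s.
Proof.
move=> Lp Vp fp; have [a [b [tab hD]]] := dom_interval Lp Vp fp.
have [q hq] : dom p t ((a + b) / 2) by apply/hD; lra.
exists q, ((a + b) / 2); split=> //; have [Lq Vq fq] := flow_tgt hq; split=> //.
exists ((b - a) / 2); first by lra.
move=> s; rewrite (dom_flow s hq) hD ltr_norml.
by split=> h; lra.
Qed.

(** Both descriptions of the common domain are intervals, and an interval has only one centre. *)
Lemma mid_uniq q t q' t' : is_mid q t -> is_mid q' t' -> flow q t t' q' -> q = q'.
Proof.
move=> [Lq Vq fq [h h0 hD]] [_ _ _ [h' h'0 hD']] fl.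
suff tt : t = t' by apply: (flow_uniq (flow_refl Lq Vq fq)); rewrite {2}tt.
have E s : `|s - t| < h <-> `|s - t'| < h' by rewrite -hD -hD' (dom_flow s fl).
have ball_sub u (x : R) u' x' : 0 < x' -> (forall s, `|s - u| < x -> `|s - u'| < x') ->
    0 < x -> u + x <= u' + x' /\ u' - x' <= u - x.
  move=> x'0 sub x0; split; rewrite leNgt; apply/negP => lt.
    have : `|Num.max u (u' + x') - u'| < x'.
      by apply: sub; rewrite ltr_norml; case: (leP u (u' + x')) => ?; lra.
    by rewrite ltr_norml; case: (leP u (u' + x')) => ?; lra.
  have : `|Num.min u (u' - x') - u'| < x'.
    by apply: sub; rewrite ltr_norml; case: (leP u (u' - x')) => ?; lra.
  by rewrite ltr_norml; case: (leP u (u' - x')) => ?; lra.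
have [e1 e2] := ball_sub t h t' h' h'0 (fun s => (E s).1) h0.
have [e3 e4] := ball_sub t' h' t h h0 (fun s => (E s).2) h'0.
by lra.
Qed.

Lemma circle_eq s t : e s = e t ->
  exists n, t = s + T *+ n \/ s = t + T *+ n.
Proof.
move=> est; have [st|ts] := leP s t.
  by have [n h] := circle_eq_le eps0 st est; exists n; left.
by have [n h] := circle_eq_le eps0 (ltW ts) (esym est); exists n; right.
Qed.

(** Two arguments of the same value differ by whole turns, so the choice of argument only shifts the
    parameter. *)
Lemma flow_change p t t' s q : f p = e t' -> flow p t s q ->
  exists s', flow p t' s' q.
Proof.
move=> fp h; have [_ _ fp'] := flow_src h.
have [|n [tE|tE]] := @circle_eq t t'; first by rewrite -fp -fp'.
  by exists (s + T *+ n); rewrite tE; exact/flow_shift.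
by exists (s - T *+ n); apply/(@flow_shift n); rewrite subrK -tE.
Qed.

Lemma mid_change q t t' : is_mid q t -> e t = e t' -> is_mid q t'.
Proof.
move=> [Lq Vq fq [h h0 hD]] ett; split=> //; first by rewrite fq.
exists h => // s; have [n [tE|tE]] := circle_eq ett.
  have -> : s - t' = s - T *+ n - t by rewrite tE; ring.
  rewrite -hD; split=> -[y hy]; exists y.
    by apply/(@flow_shift n); rewrite subrK -tE.
  by rewrite tE -[s](subrK (T *+ n)); apply/flow_shift.
have -> : s - t' = s + T *+ n - t by rewrite tE; ring.
rewrite -hD; split=> -[y hy]; exists y; first by rewrite tE; apply/flow_shift.
by apply/(@flow_shift n); rewrite -tE.
Qed.

Lemma circle_mid t h : e (t - h) * e (t + h) = e t ^+ 2.
Proof.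
have h1 : cos h ^+ 2 = 1 - sin h ^+ 2 by exact: cos2sin2.
have h2 : cos t ^+ 2 = 1 - sin t ^+ 2 by exact: cos2sin2.
apply: cpx_ext; rewrite expr2 ?creM ?cimM !creE !cimE ?cosD ?sinD ?cosN ?sinN.
  have -> : eps * (cos t * cos h - sin t * - sin h) *
    (eps * (cos t * cos h - sin t * sin h)) -
    eps * (sin t * cos h + cos t * - sin h) * (eps * (sin t * cos h + cos t * sin h)) =
    eps ^+ 2 * (cos t ^+ 2 - sin t ^+ 2) * (cos h ^+ 2 + sin h ^+ 2) by ring.
  by rewrite cos2Dsin2; ring.
have -> : eps * (cos t * cos h - sin t * - sin h) *
    (eps * (sin t * cos h + cos t * sin h)) +
    eps * (sin t * cos h + cos t * - sin h) * (eps * (cos t * cos h - sin t * sin h)) =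
    2 * eps ^+ 2 * cos t * sin t * (cos h ^+ 2 + sin h ^+ 2) by ring.
by rewrite cos2Dsin2; ring.
Qed.

(* The value of [f] at the midpoint of an edge is, up to sign, determined by its
   values at the two ends: this bounds the number of edges. *)
Lemma mid_finite : finite_set [set q | exists t, is_mid q t].
Proof.
have fin : finite_set (\bigcup_(v in V) \bigcup_(w in V)
    (L `&` [set z | L z /\ f z ^+ 2 = f v * f w])).
  by apply: bigcup_finite => // v _; apply: bigcup_finite => // w _; exact: sqr_fiber_finite.
apply: sub_finite_set fin => q [t [Lq Vq fq [h h0 hD]]].
have [||g [[_ [V0 V1] _ _] f0 f1 _ _]] := @flow_edge q t (t - h) (t + h).
- by lra.
- by move=> s; rewrite hD ltr_norml; split=> ?; lra.
exists (g 0) => //; exists (g 1) => //; split=> //; split=> //.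
by rewrite f0 f1 circle_mid fq.
Qed.

Lemma embedded_graph_edges : embedded_graph L V.
Proof.
split=> //; have /finite_seqP[s0 sE] := mid_finite.
(* Without duplicates, distinct indices mean distinct midpoints, so edges with a common interior
   point have equal index by [mid_uniq]. *)
pose s := undup s0.
have s_mid q : q \in s -> exists t, is_mid q t.
  rewrite mem_undup => qs; suff : [set q | exists t, is_mid q t] q by [].
  by rewrite sE.
have mid_s q t : is_mid q t -> q \in s.
  move=> qt; rewrite mem_undup; suff : [set` s0] q by [].
  by rewrite -sE; exists t.
pose Q (i : 'I_(size s)) := nth 0 s i.
have Qs i : Q i \in s by rewrite mem_nth.
have /boolp.choice[tt htt] i := s_mid _ (Qs i).
have /boolp.choice[E hE] i : exists g, [/\ is_edge V g,
    forall x, 0 < x < 1 -> exists u, flow (Q i) (tt i) u (g x) &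
    forall q u, flow (Q i) (tt i) u q -> exists2 x, 0 < x < 1 & g x = q].
  have [Lq Vq fq [h h0 hD]] := htt i.
  have [||g [g1 _ _ g2 g3]] := @flow_edge (Q i) (tt i) (tt i - h) (tt i + h).
  - by lra.
  - by move=> u; rewrite hD ltr_norml; split=> ?; lra.
  by exists g; split=> // x /g2 hx; exists (tt i - h + (tt i + h - (tt i - h)) * x).
exists (size s), E; split.
- by move=> i; have [] := hE i.
- move=> i j x y; rewrite !in_itv /= => x01 y01 ij Exy.
  have [_ hi _] := hE i; have [_ hj _] := hE j.
  have [u hu] := hi x x01; have [v hv] := hj y y01; rewrite -Exy in hv.
  have [w hw] : exists w, flow (E i x) u w (Q j).
    apply: (flow_change _ (flow_sym hv)).
    by have [] := flow_tgt hu.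
  have fij := flow_trans hu hw.
  have [_ _ fQj] := flow_tgt fij.
  have mj : is_mid (Q j) w.
    by apply: mid_change (htt j) _; have [_ _ <- _] := htt j.
  have /eqP : Q i = Q j by exact: mid_uniq (htt i) mj fij.
  by rewrite nth_uniq ?undup_uniq // => /eqP/val_inj ijE; rewrite ijE eqxx in ij.
- apply/seteqP; split=> z.
    move=> Lz; have [Vz|Vz] := pselect (V z); first by left.
    right; have [t zt] := circle_surj eps0 (feps Lz).
    have [q [u [zq qmid]]] := mid_exists Lz Vz zt.
    have qs := mid_s _ _ qmid; have qi : (index q s < size s)%N by rewrite index_mem.
    exists (Ordinal qi) => //; pose i := Ordinal qi.
    have Qi : Q i = q by rewrite /Q nth_index.
    have [Lq Vq fq _] := htt i.
    have [w hw] : exists w, flow (Q i) (tt i) w z.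
      by apply: (flow_change fq (t := u) (s := t)); rewrite Qi; exact: flow_sym.
    have [_ _ hs] := hE i; have [x x01 <-] := hs _ _ hw.
    by exists x => //=; rewrite in_itv /=; lra.
  move=> [/VL//|[i _ [x /= + <-]]]; rewrite in_itv /= => x01.
  have [[_ [V0 V1] _ _] hi _] := hE i.
  have [->|x0] := eqVneq x 0; first exact: VL.
  have [->|x1] := eqVneq x 1; first exact: VL.
  have [|u /flow_tgt[]//] := hi x.
  by rewrite !lt_neqAle eq_sym x0 x1.
Qed.

(** Every edge has its ends in [V]. Hence a component without critical points must carry a closed
    orbit. *)
Lemma vertex_exists : L !=set0 -> V !=set0.
Proof.
move=> [p Lp]; have [Vp|Vp] := pselect (V p); first by exists p.
have [t pt] := circle_surj eps0 (feps Lp).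
have [a [b [tab hD]]] := dom_interval Lp Vp pt.
by have [g [[_ [V0 _] _ _] _ _ _ _]] := flow_edge tab hD; exists (g 0).
Qed.

End Flow.

(** * Components of level sets *)

Section LevelComponent.
Variables (R : realType).
Notation C := (Cplx R).
Implicit Types (f : C -> C) (z w : C).

Lemma pole_large f z (M : R) : is_pole f z ->
  exists2 d : R, 0 < d & forall w, cmod (w - z) < d -> w != z -> M < cmod (f w).
Proof.
move=> hp.
have /nbhs'_cmod[d d0 hd] : nbhs z^' [set w | M%:C%C < `|f w|].
  apply: (hp [set x | M%:C%C < x]); exists M%:C%C; split=> //.
  by apply/complex_realP; exists M.
by exists d => // w wz wnz; have := hd w wz wnz; rewrite /= normC ltcR.
Qed.

(** Needed to place points in [level_set], which excludes poles: continuity bounds [f] near [z],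
    while a pole exceeds that bound. *)
Lemma cder_not_pole f z k : cder f z k -> ~ is_pole f z.
Proof.
move=> /cder_cont/(_ 1 ltr01)[d2 d20 h2] /(pole_large (cmod (f z) + 1))[d1 d10 h1].
pose d := Num.min d1 d2 / 2.
have d0 : 0 < d by rewrite divr_gt0 // lt_min d10.
have [dd1 dd2] : d < d1 /\ d < d2.
  have : Num.min d1 d2 = 2 * d by rewrite /d; field.
  set m := Num.min _ _ => mE.
  have : m <= d1 by rewrite ge_min lexx.
  have : m <= d2 by rewrite ge_min lexx orbT.
  by move=> ? ?; split; lra.
have dC : cmod (d%:C%C : Cplx R) = d by rewrite cmod_real gtr0_norm.
have dz : z + d%:C%C != z by rewrite -subr_eq0 addrKC -cmod_gt0 dC.
have := h2 (z + d%:C%C); rewrite addrKC dC => /(_ dd2).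
have := h1 (z + d%:C%C); rewrite addrKC dC => /(_ dd1 dz).
by have := cmodB_ge (f (z + d%:C%C)) (f z); lra.
Qed.

Lemma disc_connected z (r : R) : connected [set w : C | cmod (w - z) < r].
Proof.
have -> : [set w : C | cmod (w - z) < r] =
    \bigcup_(w in [set w : C | cmod (w - z) < r])
      ((fun t : R => z + t%:C%C * (w - z)) @` `[0, 1]).
  apply/seteqP; split=> w /=.
    move=> wr; exists w => //=; exists 1; rewrite ?in_itv /= ?ler01 ?lexx //.
    by rewrite mul1r subrKC.
  move=> [v /= vr [t /=]]; rewrite in_itv /= => /andP[t0 t1] <-.
  rewrite addrKC cmodM cmod_real ger0_norm //; apply: le_lt_trans vr.
  by rewrite -[leRHS]mul1r ler_wpM2r // cmod_ge0.
apply: bigcup_connected.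
  exists z => w _; exists 0; rewrite /= ?in_itv /= ?lexx ?ler01 //.
  by rewrite mul0r addr0.
move=> w _; apply: connected_continuous_connected; first exact: segment_connected.
apply: continuous_subspaceT => t; apply/pcontP => e e0.
have K0 : 0 < cmod (w - z) + 1 by have := cmod_ge0 (w - z); lra.
exists (e / (cmod (w - z) + 1)); first by rewrite divr_gt0.
move=> s st; have -> : z + s%:C%C * (w - z) - (z + t%:C%C * (w - z)) =
   (s - t)%:C%C * (w - z) by rewrite rmorphB; ring.
rewrite cmodM cmod_real; move: st; rewrite ltr_pdivlMr //.
by have := normr_ge0 (s - t); nra.
Qed.

Lemma cre_cont (A : set C) : {within A, continuous (fun z : C => cre z)}.
Proof.
apply: continuous_subspaceT => z.
apply: (@cvgrPdist_lt _ _ _ (nbhs z) (nbhs_filter z) _ _).2 => e e0.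
apply/nbhs_cmod; exists e => // w; apply: le_lt_trans.
by rewrite -creB cmodB cre_le.
Qed.

(** The real part attains its maximum on [A], but in an open set one can move further right. *)
Lemma compact_not_open (A : set C) : A !=set0 -> compact A -> ~ open A.
Proof.
move=> A0 cA oA.
have [z /set_mem Az zmax] := compact_EVT_max A0 cA (@cre_cont A).
have [d d0 hd] := open_cmod oA Az.
have dC : cmod ((d / 2)%:C%C : C) = d / 2 by rewrite cmod_real gtr0_norm ?divr_gt0.
have Aw : A (z + (d / 2)%:C%C) by apply: hd; rewrite addrKC dC; lra.
have := zmax _ (mem_set Aw); rewrite creD.
have -> : cre ((d / 2)%:C%C : C) = d / 2 by [].
by lra.
Qed.

(** * The component: compactness, nonconstancy, charts *)

Section Component.
Variables (G G' : set C) (f : C -> C) (eps : R) (L : set C).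
Hypothesis G'_open : open G'.
Hypothesis clG_sub : closure G `<=` G'.
Hypothesis f_mero : meromorphic G' f.
Hypothesis eps0 : 0 < eps.
Hypothesis L_comp : is_connected_component (level_set G' f eps) L.
Hypothesis L_bounded : bounded_set L.
Hypothesis L_sub : L `<=` G.

Notation E := (level_set G' f eps).

Lemma component_level : L `<=` E.
Proof. by case: L_comp => x Ex ->; exact: connected_component_sub. Qed.

Lemma component_conn : connected L.
Proof. by case: L_comp => x Ex ->; exact: component_connected. Qed.

Lemma component_neq0 : L !=set0.
Proof. by case: L_comp => x Ex ->; exists x; exact: connected_component_refl. Qed.

(** The source of membership in [L] for closures, discs and arcs alike. *)
Lemma component_max (A : set C) z : connected A -> A `<=` E -> A z -> L z -> A `<=` L.
Proof.
move=> connA AE Az Lz; have [x Ex LE] := L_comp.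
have Lx : L x by rewrite LE; exact: connected_component_refl.
have : A `|` L `<=` connected_component E x.
  apply: connected_component_max; first by right.
    by move=> y [/AE//|/component_level].
  by apply: connectedU => //; [exists z|exact: component_conn].
by rewrite -LE => h y Ay; apply: h; left.
Qed.

Lemma level_mod z : E z -> cmod (f z) = eps.
Proof. by move=> [_ _]; rewrite normC => /complexI. Qed.

Lemma derivable_level z : G' z -> (exists k, cder f z k) -> cmod (f z) = eps -> E z.
Proof.
by move=> Gz [k dk] fz; split=> //; [exact: cder_not_pole dk|rewrite normC fz].
Qed.

Lemma level_regular z : G' z -> ~ is_pole f z -> exists2 r : R, 0 < r &
  forall w, cmod (w - z) < r -> G' w /\ exists k, cder f w k.
Proof.
move=> Gz nz; have [nd [/derivable_cder dz|//]] := f_mero Gz.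
have /nbhs'_cmod[d1 d10 h1] := nd.
have [d2 d20 h2] := open_cmod G'_open Gz.
exists (Num.min d1 d2) => [|w]; first by rewrite lt_min d10.
rewrite lt_min => /andP[w1 /h2 Gw]; split=> //.
have [->//|wz] := eqVneq w z.
by apply/derivable_cder; exact: h1.
Qed.

Lemma component_regular z : L z -> exists2 r : R, 0 < r &
  forall w, cmod (w - z) < r -> G' w /\ exists k, cder f w k.
Proof. by move=> /component_level[Gz nz _]; exact: level_regular. Qed.

Lemma component_der z : L z -> exists k, cder f z k.
Proof.
move=> Lz; have [r r0 hr] := component_regular Lz.
by have [] := hr z; rewrite ?subrr ?cmod0.
Qed.

(** A limit point of [L] lies in the closure of [G], hence in [G']; it is no pole, as [f] has
    modulus [eps] on [L]; so it belongs to the level set by continuity. Then the closure of [L] is a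
    connected part of the level set. *)
Lemma component_closed : closed L.
Proof.
have clE : closure L `<=` E.
  move=> z clz.
  have near (d : R) : 0 < d -> exists2 w, L w & cmod (w - z) < d.
    move=> d0; have /clz[w [Lw wz]] : nbhs z [set w | cmod (w - z) < d].
      by apply/nbhs_cmod; exists d.
    by exists w.
  have [Lz|nLz] := pselect (L z); first exact: component_level.
  have Gz : G' z by apply: clG_sub; exact: closureS clz.
  have nz : ~ is_pole f z.
    move=> /(pole_large eps)[d d0 hd]; have [w Lw wz] := near d d0.
    have wnz : w != z by apply/eqP => wz'; apply: nLz; rewrite -wz'.
    by have := hd w wz wnz; rewrite level_mod ?ltxx //; exact: component_level.
  have [r r0 hr] := level_regular Gz nz.
  have [|_ dz] := hr z; first by rewrite subrr cmod0.
  apply: derivable_level => //; have [k /cder_cont cz] := dz.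
  apply/eqP; rewrite -subr_eq0 -normr_eq0 eq_le normr_ge0 andbT leNgt.
  apply/negP => h0; have [d d0 hd] := cz _ h0.
  have [w /component_level/level_mod fw wz] := near d d0.
  have := hd w wz; rewrite ltNge => /negP; apply.
  have := cmodB_ge (f w) (f z); have := cmodB_ge (f z) (f w).
  by rewrite [cmod (f z - f w)]cmodB fw ler_norml; lra.
have [z Lz] := component_neq0.
suff <- : closure L = L by exact: closed_closure.
apply/seteqP; split; last exact: subset_closure.
apply: (component_max (z := z)) => //; last exact: subset_closure.
by apply: connected_closure; exact: component_conn.
Qed.

Lemma component_compact : compact L.
Proof.
have [M [Mreal hM]] := L_bounded.
have /complex_realP[m mE] := Mreal.
apply: (@compact_bounded_closed _ L (m + 1)); first exact: component_closed.
move=> z Lz; have mm : M < (m + 1)%:C%C by rewrite mE ltcR ltrDl.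
by have := hM _ mm z Lz; rewrite /= normC lecR.
Qed.

Definition locally_cst z := exists2 r : R, 0 < r &
  forall w, cmod (w - z) < r -> f w = f z.

Lemma locally_cst_near z : locally_cst z -> exists2 r : R, 0 < r &
  forall w, cmod (w - z) < r -> locally_cst w.
Proof.
move=> [r r0 hr]; exists r => // w wz; exists (r - cmod (w - z)).
  by rewrite subr_gt0.
move=> u uw; rewrite !hr //; have := cmod_tri u w z; lra.
Qed.

Lemma locally_cst_cder0 z : locally_cst z -> cder f z 0.
Proof.
move=> [r r0 hr] e e0; exists r => // w /hr ->.
by rewrite subrr mul0r subr0 cmod0 mulr_ge0 ?cmod_ge0 // ltW.
Qed.

(** Local constancy propagates along [L]: where it fails, [lipform_noncrit] makes the derivative
    nonzero at the other nearby points of differentiability, so it fails there too. If it held on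
    all of [L], small discs about points of [L] would be connected parts of the level set, making
    [L] open. *)
Lemma component_not_cst z : L z -> ~ locally_cst z.
Proof.
move=> Lz cz; apply: (compact_not_open component_neq0 component_compact).
have all_cst : forall x, L x -> locally_cst x.
  apply: (connected_forall component_conn Lz cz) => x Lx hx.
    have [r r0 hr] := locally_cst_near hx.
    by apply/nbhs_cmod; exists r => // y /hr.
  have [r r0 hr] := component_regular Lx.
  have [|[m [H [r' [K lf]]]]] := local_form r0 (fun w h => (hr w h).2).
    by move=> [r' r'0 h]; case: hx; exists r'.
  have [r2 r20 h2] := lipform_noncrit lf.
  apply/nbhs_cmod; exists r2 => // y yx _ cy.
  have [yE|ynx] := eqVneq y x; first by apply: hx; rewrite -yE.
  by apply: (h2 y yx ynx); exact: locally_cst_cder0.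
rewrite openE => x Lx; apply/nbhs_cmod.
have [r1 r10 h1] := component_regular Lx; have [r2 r20 h2] := all_cst x Lx.
exists (Num.min r1 r2) => [|w wx]; first by rewrite lt_min r10.
apply: (component_max (z := x) (@disc_connected x (Num.min r1 r2))) => //.
  move=> y /=; rewrite lt_min => /andP[/h1[Gy dy] /h2 fy].
  by apply: derivable_level => //; rewrite fy level_mod //; exact: component_level.
by rewrite /= subrr cmod0 lt_min r10.
Qed.

Lemma component_lipform z : L z -> exists m H r K, lipform f z m H r K.
Proof.
move=> Lz; have [r r0 hr] := component_regular Lz.
by have [/(component_not_cst Lz)//|] := local_form r0 (fun w h => (hr w h).2).
Qed.

Notation V := [set z | L z /\ critical_point f z].

Lemma critical_cder z : critical_point f z -> cder f z 0.
Proof.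
by move=> [/derivable_cder[k dk] d0]; have := cder_derive1 dk; rewrite d0 => ->.
Qed.

Lemma critical_finite : finite_set V.
Proof.
have -> : V = L `&` V by apply/seteqP; split=> z; [case|case].
apply: compact_isolated_finite; first exact: component_compact.
move=> z Lz; have [m [H [r [K lf]]]] := component_lipform Lz.
have [r' r'0 h] := lipform_noncrit lf; exists r' => // w wz wnz [_ /critical_cder].
exact: h.
Qed.

(** [psi] is the local inverse of [f] composed with the circle; its continuity follows from the
    lower bound on increments of [f]. *)
Lemma component_chart p t : L p -> ~ V p -> f p = circle eps t ->
  exists (eta r : R) (psi : R -> C), [/\ 0 < eta <= 1, 0 < r, psi t = p,
    forall u, `|u - t| < eta ->
      [/\ pcont psi u, f (psi u) = circle eps u, L (psi u) & ~ V (psi u)] &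
    forall y, L y -> cmod (y - p) < r -> exists2 u, `|u - t| < eta & y = psi u].
Proof.
move=> Lp Vp fp; have [k dk] := component_der Lp.
have k0 : k != 0.
  apply/eqP => k0; apply: Vp; split=> //; split; last by rewrite (cder_derive1 dk).
  by apply/derivable_cder; exists k.
have [r r0 hr] := component_regular Lp.
have [r1 [s [c [[/andP[r10 r1r] s0 c0 lip surj] ncrit]]]] :=
  local_inverse r0 (fun w h => (hr w h).2) dk k0.
have inj u v : cmod (u - p) < r1 -> cmod (v - p) < r1 -> f u = f v -> u = v.
  move=> ur vr fuv; have := lip u v ur vr; rewrite fuv subrr cmod0.
  by rewrite pmulr_rle0 // => h; apply/eqP; rewrite -subr_eq0 -cmod_eq0 eq_le h cmod_ge0.
have [eta1 eta10 he] := circle_cont eps0 t s0.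
pose eta := Num.min eta1 1.
have eta0 : 0 < eta by rewrite lt_min eta10 ltr01.
have /boolp.choice[psi hpsi] u : exists z, `|u - t| < eta ->
    cmod (z - p) < r1 /\ f z = circle eps u.
  have [ut|nut] := pselect (`|u - t| < eta); last by exists 0 => /nut.
  move: (ut); rewrite lt_min => /andP[/he + _]; rewrite -fp => /surj[z zr fz].
  by exists z.
have ptt : `|t - t| < eta by rewrite subrr normr0.
have psit : psi t = p.
  have [h1 h2] := hpsi t ptt; apply: inj => //; first by rewrite subrr cmod0.
  by rewrite h2.
have psic u : `|u - t| < eta -> pcont psi u.
  move=> ut e e0; have [h1 h2] := hpsi u ut.
  have [d d0 hd] := circle_cont eps0 u (mulr_gt0 c0 e0).
  exists (Num.min d (eta - `|u - t|)); first by rewrite lt_min d0 subr_gt0.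
  move=> v; rewrite lt_min => /andP[/hd vd vu].
  have [h3 h4] : cmod (psi v - p) < r1 /\ f (psi v) = circle eps v.
    by apply: hpsi; have := ler_distD u v t; lra.
  have := lip _ _ h3 h1; rewrite h2 h4 => h5.
  by rewrite -(ltr_pM2l c0); exact: le_lt_trans h5 vd.
pose I : set R := [set` `](t - eta), (t + eta)[].
have IE u : I u <-> `|u - t| < eta.
  by rewrite /I /= in_itv /= ltr_norml; split=> ?; lra.
(* The arc is a connected part of the level set through [p], so it stays in the component. *)
have psiL u : `|u - t| < eta -> L (psi u).
  move=> /IE Iu; apply: (@component_max (psi @` I) p) => //.
  - apply: connected_continuous_connected.
      by apply/connected_intervalP; exact: interval_is_interval.
    by apply: continuous_in_subspaceT => v /set_mem/IE/psic/pcontP.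
  - move=> _ [v /IE/hpsi[h1 h2] <-].
    have [|Gv dv] := hr (psi v); first exact: lt_le_trans r1r.
    by apply: derivable_level => //; rewrite h2 cmod_circle.
  by exists t => //; exact/IE.
(* Conversely, a point [y] of [L] near [p] has [f y] on the circle near [f p], so its argument can
   be taken in the window, and injectivity of [f] identifies [y] with a point of the arc. *)
have [d d0 hd] := circle_surj_near eps0 t eta0.
have [d' d'0 hd'] := cder_cont dk d0.
exists eta, (Num.min d' r1), psi; split.
- by rewrite eta0 ge_min lexx orbT.
- by rewrite lt_min d'0.
- exact: psit.
- move=> u ut; have [h1 h2] := hpsi u ut.
  split; [exact: psic|exact: h2|exact: psiL|].
  by move=> [_ /critical_cder]; exact: ncrit.
- move=> y Ly; rewrite lt_min => /andP[/hd' fy yr1]; rewrite fp in fy.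
  have [|u ut fyu] := hd (f y) _ fy; first by apply: level_mod; exact: component_level.
  by exists u => //; have [h1 h2] := hpsi u ut; apply: inj => //; rewrite h2.
Qed.

End Component.
End LevelComponent.

Unset Implicit Arguments.

Theorem corollary2p2 (R : realType) (G G' : set (Cplx R))
    (f : Cplx R -> Cplx R) (eps : R) (L : set (Cplx R))
    (G_open : open G) (G'_open : open G') (clG_sub : closure G `<=` G')
    (f_mero : meromorphic G' f) (eps_gt0 : 0 < eps)
    (L_comp : is_connected_component (level_set G' f eps) L)
    (L_bounded : bounded_set L) (L_sub : L `<=` G) :
  planar_graph L [set z | L z /\ critical_point f z] /\
  ((forall z, L z -> ~ critical_point f z) -> simple_closed_path L).
Proof.
set V := [set z | L z /\ critical_point f z].
have cL := component_compact G'_open clG_sub f_mero L_comp L_bounded L_sub.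
have connL := component_conn L_comp.
have VL : V `<=` L by move=> z [].
have cf z : L z -> ccont f z.
  move=> Lz; have [k dk] := component_der G'_open f_mero L_comp Lz.
  exact: cder_cont dk.
have feps z : L z -> cmod (f z) = eps.
  by move=> Lz; apply: level_mod; exact: component_level L_comp _ Lz.
have isol z : L z -> exists2 r : R, 0 < r &
    forall w, L w -> cmod (w - z) < r -> w != z -> f w != f z.
  move=> Lz; have [m [H [r [K lf]]]] := component_lipform G'_open clG_sub f_mero
    L_comp L_bounded L_sub Lz.
  by have [r' r'0 h] := lipform_isolated lf; exists r' => // w _; exact: h.
have finV := critical_finite G'_open clG_sub f_mero L_comp L_bounded L_sub.
have chart := component_chart G'_open f_mero eps_gt0 L_comp.
(* The two alternatives of [planar_graph]: a closed orbit fills [L] and leaves no vertices; without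
   one, [L] is an embedded graph with at least one vertex. *)
have [[q [s hqs]]|noc] := pselect (exists q s, closed_orbit eps f L V q s).
  have [sc V0] := closed_orbit_circle eps_gt0 connL VL chart hqs.
  by split=> [|_]; [right|].
have noco q s : ~ closed_orbit eps f L V q s by move=> h; apply: noc; exists q, s.
split.
  left; exact: (embedded_graph_edges eps_gt0 cL VL cf feps isol finV chart noco).
move=> ncrit.
have [v [Lv cv]] := vertex_exists eps_gt0 cL cf feps isol chart noco
  (component_neq0 L_comp).
by case: (ncrit v Lv).
Qed.
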